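(* Let $M_t=\mathbb{E}[X_1\mid X_0,I_t^{(1)}]$ be a one-arc filtered arcade martingale restricted to $t\in(T_0,T_1)$. Then $$M_t=\frac{\int_{\mathbb{R}}y\,f^{I_t^{(1)}\mid X_0,X_1=y}(I_t^{(1)})\,\mathrm dF^{X_1\mid X_0}(y)}{\int_{\mathbb{R}}f^{I_t^{(1)}\mid X_0,X_1=y}(I_t^{(1)})\,\mathrm dF^{X_1\mid X_0}(y)},$$ where $f^{I_t^{(1)}\mid X_0,X_1}$ is the conditional density of $I_t^{(1)}$ given $X_0$ and $X_1$, and $F^{X_1\mid X_0}$ is the conditional distribution function of $X_1$ given $X_0$. In particular: 1. If $(X_0,X_1)$ is a continuous random vector (with conditional density $f^{X_1\mid X_0}$ of $X_1$ given $X_0$), then $$M_t=\frac{\int_{\mathbb{R}}y\,f^{I_t^{(1)}\mid X_0,X_1=y}(I_t^{(1)})\,f^{X_1\mid X_0}(y)\,\mathrm dy}{\int_{\mathbb{R}}f^{I_t^{(1)}\mid X_0,X_1=y}(I_t^{(1)})\,f^{X_1\mid X_0}(y)\,\mathrm dy}.$$ 2. If $(X_0,X_1)$ is a discrete random vector, then $$M_t=\frac{\sum_y y\,f^{I_t^{(1)}\mid X_0,X_1=y}(I_t^{(1)})\,\mathbb P[X_1=y\mid X_0]}{\sum_y f^{I_t^{(1)}\mid X_0,X_1=y}(I_t^{(1)})\,\mathbb P[X_1=y\mid X_0]}.$$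
   Context: Equalities are understood almost surely. Let $0\leqslant T_0<T_1<\infty$. On a probability space $(\Omega,\mathcal F,\mathbb P)$ let $(D_t)_{t\in[T_0,T_1]}$ (the driver) be a real sample-continuous process such that for all $c\in\mathbb{R}$ and $t\in(T_0,T_1)$, $\mathbb P[D_t=c]<1$, and let $X=(X_0,X_1)$ be a random vector independent of $(D_t)$ with integrable components and $\mathbb{E}[X_1\mid X_0]=X_0$ a.s. (its law is a martingale coupling of its marginals). Continuous functions $f_0,f_1:[T_0,T_1]\to\mathbb{R}$ are interpolating coefficients if $f_i(T_i)=1$ and $f_i(T_j)=0$ for $i\ne j$. An $X$-randomised arcade process ($X$-RAP) on $\{T_0,T_1\}$ is a process $I_t^{(1)}=D_t-\sum_{i=0}^1(f_i(t)D_{T_i}-g_i(t)X_i)$, where $f_0,f_1$ and $g_0,g_1$ are interpolating coefficients; $\mathcal F_t^I=\sigma(I^{(1)}_u:T_0\leqslant u\leqslant t)$. The one-arc filtered arcade martingale (FAM) is $M_t=\mathbb{E}[X_1\mid\mathcal F_t^I]$. Standing assumptions: the driver has a density function for $t\in[T_0,T_1]$; and writing $M_t=\mathbb{E}[X_1\mid X_0,I_t^{(1)}]$ means that $(I_t^{(1)})$ is assumed to be $\{T_0,T_1\}$-conditionally Markov, i.e., for all $s\leqslant t$ in $[T_0,T_1]$, $\mathbb P[I_t^{(1)}\in\cdot\mid\mathcal F_s^I]=\mathbb P[I_t^{(1)}\in\cdot\mid I^{(1)}_{T_0},\dots,I^{(1)}_{T_{m(s)}},I_s^{(1)}]$ with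 $m(s)=\max\{i:T_i\leqslant s\}$ (and $I^{(1)}_{T_i}=X_i$). *)

(* Defs.v *)
From HB Require Import structures.
From mathcomp Require Import all_boot all_order all_algebra.
From mathcomp Require Import all_classical all_reals all_analysis measurable_realfun.

Set Implicit Arguments.
Unset Strict Implicit.
Unset Printing Implicit Defensive.

Import Order.TTheory GRing.Theory Num.Theory.
Import numFieldNormedType.Exports.

Local Open Scope classical_set_scope.
Local Open Scope ring_scope.

Section Sigma.
Context (d : measure_display) (T : measurableType d) (R : realType).

Definition sigma_of (d' : measure_display) (S : measurableType d')
    (X : T -> S) : set (set T) :=
  preimage_set_system setT X measurable.

Definition sigma_process (J : set R) (Y : R -> T -> R) : set (set T) :=
  <<s [set A | exists2 t, J t & sigma_of (Y t) A] >>.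

End Sigma.

Section Conditioning.
Context (d : measure_display) (T : measurableType d) (R : realType).
Variable P : probability T R.

(* [Y] is a version of E[X | G], for [G] a sub-sigma-algebra of [T]. *)
Definition is_cond_exp (G : set (set T)) (X Y : T -> \bar R) : Prop :=
  [/\ sigma_of Y `<=` G,
      P.-integrable setT Y
    & forall A, G A ->
        (\int[P]_(w in A) Y w = \int[P]_(w in A) X w)%E].

Definition is_cond_prob (G : set (set T)) (A : set T) (Y : T -> \bar R) : Prop :=
  is_cond_exp G (EFin \o \1_A) Y.

Definition independent_sigma (F G : set (set T)) : Prop :=
  forall A B, F A -> G B -> P (A `&` B) = (P A * P B)%E.

Definition has_density (d' : measure_display) (S : measurableType d')
    (mu : set S -> \bar R) (X : T -> S) : Prop :=
  exists q : S -> R,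
    [/\ measurable_fun setT q,
        forall x, 0 <= q x
      & forall A, measurable A -> P (X @^-1` A) = (\int[mu]_(x in A) (q x)%:E)%E].

(* [p x] is the conditional density of [Z] given [X = x]: jointly measurable,
   and integrating [p X] over A gives a version of P[Z in A | X]. *)
Definition is_cond_density (d' : measure_display) (S : measurableType d')
    (X : T -> S) (Z : T -> R) (p : S -> R -> R) : Prop :=
  [/\ measurable_fun setT (fun u : S * R => p u.1 u.2),
      forall x z, 0 <= p x z
    & forall A : set R, measurable A ->
        is_cond_prob (sigma_of X) (Z @^-1` A)
          (fun w => \int[lebesgue_measure]_(z in A) (p (X w) z)%:E)%E].

(* [F x] is the conditional distribution function of [Z] given [X = x]; each
   [F x] is a distribution function (nondecreasing, right-continuous, with
   limits 0 and 1) by its type. *)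
Definition is_cond_cdf (d' : measure_display) (S : measurableType d')
    (X : T -> S) (Z : T -> R) (F : S -> cumulativeBounded (0 : R) (1 : R)) : Prop :=
  forall y : R,
    measurable_fun setT (fun x : S => F x y) /\
    is_cond_prob (sigma_of X) [set w | Z w <= y] (fun w => (F (X w) y)%:E).

End Conditioning.

Section Sums.
Context (R : realType).

(* Unconditional sum of a signed family; [esum] alone is only the sum of a
   nonnegative family. *)
Definition signed_sum (S : set R) (a : R -> \bar R) : \bar R :=
  (\esum_(y in S) a^\+ y - \esum_(y in S) a^\- y)%E.

(* [m = N / D], including that the quotient makes sense.  Integrals and sums
   which are not absolutely convergent have an infinite value here, so that the
   first two conditions state convergence. *)
Definition is_quotient (m : R) (N D : \bar R) : Prop :=
  [/\ N \is a fin_num, D \is a fin_num, D != 0%E & m = fine N / fine D].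

End Sums.

Section Arcade.
Context (d : measure_display) (T : measurableType d) (R : realType).
Variables (P : probability T R) (T0 T1 : R).

Definition is_driver (D : R -> {RV P >-> R}) : Prop :=
  {ae P, forall w, {within `[T0, T1], continuous (fun t => D t w)}} /\
  (forall (c t : R), T0 < t < T1 -> (P [set w | D t w = c] < 1)%E).

Definition interpolating (f0 f1 : R -> R) : Prop :=
  [/\ {within `[T0, T1], continuous f0}, {within `[T0, T1], continuous f1},
      f0 T0 = 1 /\ f0 T1 = 0 & f1 T0 = 0 /\ f1 T1 = 1].

Definition rap (D : R -> T -> R) (X0 X1 : T -> R) (f0 f1 g0 g1 : R -> R)
    (t : R) (w : T) : R :=
  D t w - ((f0 t * D T0 w - g0 t * X0 w) + (f1 t * D T1 w - g1 t * X1 w)).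

(* {T_0, ..., T_m(s), s}, as T_m(s) is the last T_i not after s. *)
Definition markov_times (s : R) : set R :=
  [set u | ((u = T0 \/ u = T1) /\ u <= s) \/ u = s].

Definition natural_filtration (I : R -> T -> R) (t : R) : set (set T) :=
  sigma_process `[T0, t] I.

(* Two conditional probabilities, the second one with respect to a smaller
   sigma-algebra, agree almost surely iff they have a common version. *)
Definition conditionally_markov (I : R -> T -> R) : Prop :=
  forall s t : R, T0 <= s -> s <= t -> t <= T1 ->
  forall B : set R, measurable B ->
  exists Y : T -> \bar R,
    is_cond_prob P (natural_filtration I s) (I t @^-1` B) Y /\
    is_cond_prob P (sigma_process (markov_times s) I) (I t @^-1` B) Y.

Definition is_fam (I : R -> T -> R) (X1 : T -> R) (M : R -> T -> R) : Prop :=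
  forall t : R, T0 <= t <= T1 ->
    is_cond_exp P (natural_filtration I t) (EFin \o X1) (EFin \o M t).

End Arcade.

(* Main.v *)
Require Import Defs.
From HB Require Import structures.
From mathcomp Require Import all_boot all_order all_algebra finmap lra.
From mathcomp Require Import all_classical all_reals all_analysis measurable_realfun.
Import Order.TTheory GRing.Theory Num.Theory.
Import numFieldNormedType.Exports.

(** Bayes' formula for a one-arc filtered arcade martingale.  Write Z for the
    arcade process at a time t strictly between T0 and T1; at T0 and at T1 it
    is exactly X0 and X1.

    - The Markov property with arrival time T1 says that, given the whole past
      up to t, the law of X1 depends on (X0, Z) only.  So the conditional law
      of X1 given the past is its conditional law given (X0, Z).
    - If x |-> nu_x disintegrates the law of X1 over X0 and p is the conditional
      density of Z given (X0, X1), then (X0, X1, Z) has the law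
      P_X0(dx) nu_x(dy) p((x, y), z) dz.  Exchanging the order of integration,
      (X0, Z) has the density D(x, z) = nu_x(p((x, .), z)) with respect to
      P_X0(dx) dz, hence 0 < D(X0, Z) < oo almost surely, and
      nu_X0(1_B p((X0, .), Z)) / D(X0, Z) is a version of
      P[X1 in B | X0, Z] ([integral_bayes]).
    - Both sides of E[1_A phi(X1)] = E[1_A nu_X0(phi p) / D], for A in the past,
      are integrals of phi, so that the case of indicators gives all
      nonnegative phi ([filter_nneg]).  The positive and the negative part of
      y, whose integrals are finite because X1 is integrable, give the formula
      for E[X1 | past], and two versions of it agree almost surely
      ([bayes_formula]).

    The three cases only differ by nu.  Rather than kernels of measures, the
    proof uses families of positive linear functionals that are continuous
    along nondecreasing sequences: integration against a Stieltjes measure,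
    against a density, and a weighted sum over a countable set are all of this
    kind without any truncation, and two such functionals agree as soon as they
    agree on a generating pi-system ([pf_ext]).  The discrete case is a density
    with respect to the counting measure on an enumeration of the values. *)

Local Open Scope classical_set_scope.
Local Open Scope ring_scope.
Set Implicit Arguments.
Unset Strict Implicit.

Lemma preimageT_measurable d d' (T : measurableType d) (S : measurableType d')
    (f : T -> S) (B : set S) :
  measurable_fun setT f -> measurable B -> measurable (f @^-1` B).
Proof. by move=> mf mB; rewrite -[X in measurable X]setTI; exact: mf. Qed.

(** * Positive functionals *)

Definition nneg d (Y : measurableType d) (R : realType) (f : Y -> \bar R) :=
  (forall y, 0 <= f y)%E /\ measurable_fun setT f.

Section Functionals.
Local Open Scope ereal_scope.
Context {d : measure_display} {Y : measurableType d} {R : realType}.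
Implicit Types (f g : Y -> \bar R) (Phi Psi : (Y -> \bar R) -> \bar R).

(** Integration against a measure that need not be named: these are the
    properties of the integral of nonnegative functions from which everything
    below follows.  Monotonicity is a separate field because the difference of
    two functions with infinite values is not available to deduce it from
    additivity. *)
Record pos_functional Phi : Prop := {
  pfD : forall f g, nneg f -> nneg g ->
    Phi (fun y => f y + g y) = Phi f + Phi g ;
  pfZ : forall (c : R) f, (0 <= c)%R -> nneg f ->
    Phi (fun y => c%:E * f y) = c%:E * Phi f ;
  pf_le : forall f g, nneg f -> nneg g -> (forall y, f y <= g y) ->
    Phi f <= Phi g ;
  pf_cvg : forall (F : (Y -> \bar R)^nat) f, (forall n, nneg (F n)) ->
    (forall y, nondecreasing_seq (F ^~ y)) ->
    (forall y, F n y @[n --> \oo] --> f y) ->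
    Phi (F n) @[n --> \oo] --> Phi f }.

Lemma nneg_cst (c : \bar R) : 0 <= c -> nneg (fun _ : Y => c).
Proof. by move=> c0; split => //; exact: measurable_cst. Qed.

Lemma nnegM f g : nneg f -> nneg g -> nneg (fun y => f y * g y).
Proof.
move=> [f0 mf] [g0 mg]; split; first by move=> y; rewrite mule_ge0.
exact: emeasurable_funM.
Qed.

Lemma nneg_indic (A : set Y) : measurable A -> nneg (fun y => (\1_A y)%:E : \bar R).
Proof.
move=> mA; split; first by move=> y; rewrite lee_fin indicE.
by apply/measurable_EFinP; exact: measurable_indic.
Qed.

Lemma nneg_comp d' (Y' : measurableType d') (h : Y' -> Y) f :
  measurable_fun setT h -> nneg f -> nneg (f \o h).
Proof. by move=> mh [f0 mf]; split; [move=> y; exact: f0|exact: measurableT_comp]. Qed.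

Lemma pf_zero Phi : pos_functional Phi -> Phi (fun=> 0) = 0.
Proof.
move=> pP; have := pfZ pP (lexx 0%R) (nneg_cst (lexx 0)).
by rewrite !mul0e.
Qed.

Lemma pf_ge0 Phi f : pos_functional Phi -> nneg f -> 0 <= Phi f.
Proof.
move=> pP nf; rewrite -(pf_zero pP); apply: (pf_le pP) => //; by case: nf.
Qed.

(** Indicators of the sets on which the two functionals agree form a
    lambda-system, the finite mass being what allows subtraction. *)
Lemma pf_ext_indic Phi Psi (G : set (set Y)) :
  pos_functional Phi -> pos_functional Psi ->
  setI_closed G -> measurable = <<s G >> ->
  Phi (fun=> 1) < +oo -> Phi (fun=> 1) = Psi (fun=> 1) ->
  (forall A, G A -> Phi (fun y => (\1_A y)%:E) = Psi (fun y => (\1_A y)%:E)) ->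
  forall A, measurable A ->
    Phi (fun y => (\1_A y)%:E) = Psi (fun y => (\1_A y)%:E).
Proof.
move=> pP pQ GI mG P1 PQ1 PQ.
pose H := [set A : set Y | measurable A /\
  Phi (fun y => (\1_A y)%:E) = Psi (fun y => (\1_A y)%:E)].
suff : measurable `<=` H by move=> h A /h[].
rewrite mG; apply: lambda_system_subset => //; last first.
  by move=> A GA; split; [rewrite mG; exact: sub_sigma_algebra|exact: PQ].
have indT : (fun y : Y => (\1_[set: Y] y)%:E) = (fun=> 1 : \bar R).
  by apply/funext => y; rewrite indicT.
split => //.
- by split => //; rewrite indT.
- move=> A B BA [mA eA] [mB eB].
  have mAB : measurable (A `\` B) by exact: measurableD.
  split => //.
  have split_indic : (fun y => (\1_A y)%:E : \bar R) =
      (fun y => (\1_(A `\` B) y)%:E + (\1_B y)%:E).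
    apply/funext => y; rewrite -EFinD !indicE in_setD; congr EFin.
    case: (boolP (y \in B)) => yB /=; last by rewrite andbT addr0.
    by rewrite (mem_set (BA _ (set_mem yB))) /= add0r.
  have := eA; rewrite split_indic !pfD //; try exact: nneg_indic.
  have finB : Psi (fun y => (\1_B y)%:E) \is a fin_num.
    rewrite -eB ge0_fin_numE; last by apply: pf_ge0 => //; exact: nneg_indic.
    apply: le_lt_trans P1; apply: (pf_le pP) => //; first exact: nneg_indic.
    by move=> y; rewrite lee_fin indicE lern1 leq_b1.
  by rewrite eB => /(congr1 (fun z => z - Psi (fun y => (\1_B y)%:E)));
    rewrite !addeK.
- move=> F ndF HF; have mF n : measurable (F n) by have [] := HF n.
  split; first exact: bigcup_measurable.
  have ndI y : nondecreasing_seq (fun n => (\1_(F n) y)%:E : \bar R).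
    move=> m n mn; rewrite lee_fin !indicE ler_nat.
    have /subsetPset sF := ndF _ _ mn.
    by case: (boolP (y \in F m)) => // yF;
      rewrite (mem_set (sF _ (set_mem yF))).
  have cI y : (\1_(F n) y)%:E @[n --> \oo] --> ((\1_(\bigcup_n F n) y)%:E : \bar R).
    have [[N _ FNy]|nF] := pselect ((\bigcup_n F n) y).
      apply: cvg_near_cst; near=> n.
      rewrite !indicE (mem_set (_ : (\bigcup_n F n) y)); last by exists N.
      rewrite mem_set//; have : (N <= n)%N by near: n; exact: nbhs_infty_ge.
      by move=> /ndF/subsetPset; exact.
    rewrite (_ : (fun n => _) = (fun=> 0)); last first.
      apply/funext => n; rewrite indicE memNset// => Fy; apply: nF.
      by exists n.
    by rewrite indicE memNset//; exact: cvg_cst.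
  have cP := pf_cvg pP (fun n => nneg_indic (mF n)) ndI cI.
  have cQ := pf_cvg pQ (fun n => nneg_indic (mF n)) ndI cI.
  rewrite -(cvg_lim _ cP)// -(cvg_lim _ cQ)//; congr (lim (_ @ \oo)).
  by apply/funext => n; have [] := HF n.
Unshelve. all: by end_near. Qed.

Import HBNNSimple.

Lemma pf_sum_indic Phi (f : {nnsfun Y >-> R}) : pos_functional Phi ->
  Phi (fun y => (f y)%:E) =
  \sum_(r \in range f) r%:E * Phi (fun y => (\1_(f @^-1` [set r]) y)%:E).
Proof.
move=> pP.
have mf r : measurable (f @^-1` [set r]) by [].
rewrite fsbig_finite//=.
have -> : (fun y => (f y)%:E) = (fun y => \sum_(r <- fset_set (range f))
     r%:E * (\1_(f @^-1` [set r]) y)%:E).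
  apply/funext => y; rewrite fimfunE fsbig_finite//= -sumEFin.
  by apply: eq_bigr => r _; rewrite EFinM.
have r0 r : r \in fset_set (range f) -> (0 <= r)%R.
  by rewrite in_fset_set// inE => -[x _ <-].
suff sumP (s : seq R) : {subset s <= fset_set (range f)} ->
    Phi (fun y => \sum_(r <- s) r%:E * (\1_(f @^-1` [set r]) y)%:E) =
    \sum_(r <- s) r%:E * Phi (fun y => (\1_(f @^-1` [set r]) y)%:E).
  exact: sumP.
elim: s => [|r s IH] srf.
  rewrite big_nil; transitivity (Phi (fun=> 0)); last exact: pf_zero.
  by congr Phi; apply/funext => y; rewrite big_nil.
rewrite big_cons -IH; last by move=> z zs; apply: srf; rewrite inE zs orbT.
have rr : (0 <= r)%R by apply: r0; apply: srf; rewrite inE eqxx.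
rewrite -pfZ//; last exact: nneg_indic.
rewrite -pfD//; last 2 first.
  by apply: nnegM; [exact: nneg_cst|exact: nneg_indic].
  split => [y|].
    rewrite big_seq; apply: sume_ge0 => z zs; rewrite mule_ge0//.
    by rewrite lee_fin; apply: r0; apply: srf; rewrite inE zs orbT.
  apply: emeasurable_sum => z; apply: measurable_funeM.
  by have [] := nneg_indic (mf z).
by congr Phi; apply/funext => y; rewrite big_cons.
Qed.

(** A nonnegative measurable function is the limit of a nondecreasing sequence
    of simple functions, so a functional is determined by its values on
    indicators; and those are determined on a pi-system. *)
Lemma pf_ext Phi Psi (G : set (set Y)) :
  pos_functional Phi -> pos_functional Psi ->
  setI_closed G -> measurable = <<s G >> ->
  Phi (fun=> 1) < +oo -> Phi (fun=> 1) = Psi (fun=> 1) ->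
  (forall A, G A -> Phi (fun y => (\1_A y)%:E) = Psi (fun y => (\1_A y)%:E)) ->
  forall f, nneg f -> Phi f = Psi f.
Proof.
move=> pP pQ GI mG P1 PQ1 PQ f [f0 mf].
pose F := nnsfun_approx measurableT mf.
have nF n : nneg (fun y => (F n y)%:E).
  by split => [y|]; [rewrite lee_fin|exact/measurable_EFinP].
have ndF y : nondecreasing_seq (fun n => (F n y)%:E).
  by move=> m n mn; rewrite lee_fin; exact/lefP/nd_nnsfun_approx.
have cF y : (F n y)%:E @[n --> \oo] --> f y by exact: cvg_nnsfun_approx.
have cP := pf_cvg pP nF ndF cF.
have cQ := pf_cvg pQ nF ndF cF.
rewrite -(cvg_lim _ cP)// -(cvg_lim _ cQ)//; congr (lim (_ @ \oo)).
apply/funext => n; rewrite !pf_sum_indic//.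
apply: eq_fsbigr => r _; congr (_ * _).
by apply: (pf_ext_indic (G := G)).
Qed.

End Functionals.

Section FunctionalConstructions.
Local Open Scope ereal_scope.
Context {R : realType}.

(** The weight is real-valued, so that multiplying by it preserves limits even
    where the functions are infinite. *)
Lemma pf_weight d d' (Y : measurableType d) (Y' : measurableType d')
    (Phi : (Y -> \bar R) -> \bar R) (j : Y -> Y') (g : Y -> R) :
  pos_functional Phi -> measurable_fun setT j ->
  (forall y, 0 <= g y)%R -> measurable_fun setT g ->
  pos_functional (fun f : Y' -> \bar R => Phi (fun y => f (j y) * (g y)%:E)).
Proof.
move=> pP mj g0 mg.
have ng : nneg (EFin \o g).
  by split => [y|]; [rewrite lee_fin|exact/measurable_EFinP].
have nfg (f : Y' -> \bar R) : nneg f -> nneg (fun y => f (j y) * (g y)%:E).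
  by move=> nf; apply: nnegM => //; exact: nneg_comp.
split.
- move=> f h nf nh; rewrite -(pfD pP) //; try exact: nfg.
  congr Phi; apply/funext => y; rewrite ge0_muleDl//; first by case: nf.
  by case: nh.
- move=> c f c0 nf; rewrite -(pfZ pP) //; last exact: nfg.
  by congr Phi; apply/funext => y; rewrite muleA.
- move=> f h nf nh fh; apply: (pf_le pP); try exact: nfg.
  by move=> y; rewrite lee_wpmul2r// lee_fin.
- move=> F f nF ndF cF; apply: (pf_cvg pP).
  + by move=> n; exact: nfg.
  + by move=> y m n mn; rewrite lee_wpmul2r ?lee_fin//; exact: ndF.
  + by move=> y; apply: cvgeZr => //; exact: cF.
Qed.

Lemma pf_comp d d' (Y : measurableType d) (Y' : measurableType d')
    (Phi : (Y -> \bar R) -> \bar R) (j : Y -> Y') :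
  pos_functional Phi -> measurable_fun setT j ->
  pos_functional (fun f : Y' -> \bar R => Phi (fun y => f (j y))).
Proof.
move=> pP mj; have := @pf_weight _ _ _ _ Phi j (fun=> 1%R) pP mj.
under [X in _ -> _ -> pos_functional X]eq_fun do under eq_fun do rewrite mule1.
by apply.
Qed.

(** A mixture of functionals is again one: this is monotone convergence applied
    to the mixing measure. *)
Lemma pf_integral_family d d' (W : measurableType d) (Y : measurableType d')
    (m : {measure set W -> \bar R}) (A : set W)
    (Phi : W -> (Y -> \bar R) -> \bar R) :
  measurable A -> (forall w, pos_functional (Phi w)) ->
  (forall f, nneg f -> measurable_fun setT (Phi ^~ f)) ->
  pos_functional (fun f => \int[m]_(w in A) Phi w f).
Proof.
move=> mA pP mP.
have mPA f : nneg f -> measurable_fun A (Phi ^~ f).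
  by move=> nf; apply: measurable_funTS; exact: mP.
split.
- move=> f g nf ng; rewrite -ge0_integralD//; try exact: mPA.
  + by apply: eq_integral => w _; rewrite (pfD (pP w)).
  + by move=> w _; exact: pf_ge0 (pP w) nf.
  + by move=> w _; exact: pf_ge0 (pP w) ng.
- move=> c f c0 nf; rewrite -ge0_integralZl//; try exact: mPA.
  + by apply: eq_integral => w _; rewrite (pfZ (pP w)).
  + by move=> w _; exact: pf_ge0 (pP w) nf.
- move=> f g nf ng fg; apply: ge0_le_integral => //; try exact: mPA.
  + by move=> w _; exact: pf_ge0 (pP w) nf.
  + by move=> w _; apply: (pf_le (pP w)).
- move=> F f nF ndF cF.
  have cP w : Phi w (F n) @[n --> \oo] --> Phi w f by exact: (pf_cvg (pP w)).
  rewrite (_ : (fun g => \int[m]_(w in A) Phi w g) f =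
      \int[m]_(w in A) limn (fun n => Phi w (F n))); last first.
    by apply: eq_integral => w _; rewrite (cvg_lim _ (cP w)).
  apply: cvg_monotone_convergence => //.
  + by move=> n; exact: mPA.
  + by move=> n w _; exact: pf_ge0 (pP w) (nF n).
  + by move=> w _ k n kn; apply: (pf_le (pP w)) => // y; exact: ndF.
Qed.

Lemma pf_integral d (Y : measurableType d) (m : {measure set Y -> \bar R}) :
  pos_functional (fun f : Y -> \bar R => \int[m]_y f y).
Proof.
apply: (@pf_integral_family _ _ _ _ m setT (fun y f => f y)) => //.
by move=> f [].
Qed.

Lemma nneg_integral_section d d' (X : measurableType d) (Y : measurableType d')
    (m : {sigma_finite_measure set Y -> \bar R}) (h : X * Y -> \bar R) :
  nneg h -> nneg (fun x => \int[m]_y h (x, y)).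
Proof.
move=> [h0 mh]; split; first by move=> x; apply: integral_ge0 => y _.
exact: (@measurable_fun_fubini_tonelli_F _ _ _ _ _ m h mh h0).
Qed.

Lemma nneg_lebesgue_section d (X : measurableType d) (h : X * R -> \bar R) :
  nneg h -> nneg (fun x => \int[@lebesgue_measure R]_y h (x, y)).
Proof. exact: (@nneg_integral_section _ _ X _ lebesgue_measure). Qed.

End FunctionalConstructions.

(** * Versions of conditional expectations *)

Section ConditionalExpectation.
Local Open Scope ereal_scope.
Context {d : measure_display} {T : measurableType d} {R : realType}.
Variable P : probability T R.

Lemma sigma_of_measurable_lt (G : set (set T)) (Y1 Y2 : T -> \bar R) :
  sigma_algebra setT G -> sigma_of Y1 `<=` G -> sigma_of Y2 `<=` G ->
  G [set w | Y1 w < Y2 w].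
Proof.
move=> sG GY1 GY2.
have GE : <<s G >> = G by exact: sigma_algebra_id.
have mG (Y : T -> \bar R) : sigma_of Y `<=` G ->
    measurable_fun setT (Y : g_sigma_algebraType G -> \bar R).
  move=> GY _ B mB; rewrite /measurable /= GE; apply: GY.
  by exists B.
have := @measurable_lte _ (g_sigma_algebraType G) R setT measurableT _ _
  (mG _ GY1) (mG _ GY2).
by rewrite setTI /measurable /= GE.
Qed.

(** The set where the inequality is strict belongs to the sigma-algebra, so it
    may be used as a test set: the difference is positive there and has a
    nonpositive integral. *)
Lemma null_lt_of_integral_le (G : set (set T)) (Y1 Y2 : T -> \bar R) :
  sigma_algebra setT G -> G `<=` measurable ->
  sigma_of Y1 `<=` G -> P.-integrable setT Y1 ->
  sigma_of Y2 `<=` G -> P.-integrable setT Y2 ->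
  (forall A, G A -> \int[P]_(w in A) Y2 w <= \int[P]_(w in A) Y1 w) ->
  P [set w | Y1 w < Y2 w] = 0.
Proof.
move=> sG Gm GY1 iY1 GY2 iY2 le21.
set A := [set w | _]; have GA : G A by exact: sigma_of_measurable_lt.
have mA : measurable A by exact: Gm.
have iA (Y : T -> \bar R) : P.-integrable setT Y -> P.-integrable A Y.
  by move=> iY; exact: (integrableS measurableT mA).
have e0 : \int[P]_(w in A) `|Y2 w - Y1 w| = 0.
  apply/eqP; rewrite eq_le integral_ge0// andbT.
  rewrite (_ : \int[P]_(w in A) _ = \int[P]_(w in A) (Y2 w - Y1 w)).
    rewrite integralB//; try exact: iA.
    rewrite sube_le0; exact: le21.
  apply: eq_integral => w /set_mem /= Aw; rewrite gee0_abs//.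
  by rewrite ltW// sube_gt0.
have mY : measurable_fun A (fun w => Y2 w - Y1 w).
  by apply: emeasurable_funB; [have /integrableP[] := iA _ iY2|have /integrableP[] := iA _ iY1].
have [N [mN N0 AN]] := (ae_eq_integral_abs P mA mY).1 e0.
apply: (subset_measure0 _ _ _ N0) => //.
move=> w Aw; apply: AN => /(_ Aw) /= e.
by move: Aw; rewrite /A /= -sube_gt0 e ltxx.
Qed.

Lemma cond_exp_unique (G : set (set T)) (X Y1 Y2 : T -> \bar R) :
  sigma_algebra setT G -> G `<=` measurable ->
  is_cond_exp P G X Y1 -> is_cond_exp P G X Y2 ->
  {ae P, forall w, Y1 w = Y2 w}.
Proof.
move=> sG Gm h1 h2.
have [[G1 i1 e1] [G2 i2 e2]] := (h1, h2).
have h12 : P [set w | Y1 w < Y2 w] = 0.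
  by apply: (null_lt_of_integral_le sG Gm) => // A GA; rewrite e1// e2.
have h21 : P [set w | Y2 w < Y1 w] = 0.
  by apply: (null_lt_of_integral_le sG Gm) => // A GA; rewrite e1// e2.
exists ([set w | Y1 w < Y2 w] `|` [set w | Y2 w < Y1 w]); split.
- by apply: measurableU; apply: Gm; exact: sigma_of_measurable_lt.
- apply/eqP; rewrite -measure_le0.
  rewrite (le_trans (measureU2 _ _ _))//.
  + by apply: Gm; exact: sigma_of_measurable_lt.
  + by apply: Gm; exact: sigma_of_measurable_lt.
  + by rewrite [X in X + _]h12 [X in _ + X]h21 adde0.
- move=> w /= /eqP; rewrite neq_lt => /orP[]; first by left.
  by right.
Qed.

Lemma cond_prob_ge0 (G : set (set T)) (A : set T) (Y : T -> \bar R) :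
  sigma_algebra setT G -> G `<=` measurable -> measurable A ->
  is_cond_prob P G A Y -> {ae P, forall w, 0 <= Y w}.
Proof.
move=> sG Gm mA [GY iY eY].
have G0 : sigma_of (cst 0 : T -> \bar R) `<=` G.
  have [g0 gD _] := sG.
  move=> _ [B _ <-]; rewrite preimage_cst setTI; case: ifPn => _ //.
  by rewrite -(setD0 setT); exact: gD.
have PY : P [set w | Y w < cst 0 w] = 0.
  apply: (null_lt_of_integral_le sG Gm) => //; first exact: integrable0.
  move=> A' GA; rewrite eY// integral0; apply: integral_ge0 => w _.
  by rewrite lee_fin indicE.
exists [set w | Y w < cst 0 w]; split => //.
  by apply: Gm; exact: sigma_of_measurable_lt.
by move=> w /= /negP; rewrite -ltNge.
Qed.

End ConditionalExpectation.

(** * Bayes' formula for a disintegrated law *)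

Section Disintegration.
Local Open Scope ereal_scope.
Context {d : measure_display} {T : measurableType d} {R : realType}.
Variable P : probability T R.
Variables X0 X1 Z : T -> R.
Implicit Types (Lam : R -> (R -> \bar R) -> \bar R).

(** [Lam x] is the integral against the conditional law of X1 given X0 = x.
    Measurability is asked jointly with a second parameter, which will be the
    value of the third variable, and the exchange with Lebesgue integration in
    that parameter is asked because [Lam x] is not required to come from a
    sigma-finite measure. *)
Record disintegration Lam : Prop := {
  dis_pf : forall x, pos_functional (Lam x) ;
  dis_measurable : forall h : (R * R) * R -> \bar R, nneg h ->
    measurable_fun setT (fun u : R * R => Lam u.1 (fun y => h (u, y))) ;
  dis_fubini : forall x (h : R * R -> \bar R), nneg h ->
    \int[lebesgue_measure]_z Lam x (fun y => h (y, z)) =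
    Lam x (fun y => \int[lebesgue_measure]_z h (y, z)) ;
  dis_law : forall A B, measurable A -> measurable B ->
    \int[P]_(w in X0 @^-1` A) Lam (X0 w) (fun y => (\1_B y)%:E) =
    P (X0 @^-1` A `&` X1 @^-1` B) }.

Variable Lam : R -> (R -> \bar R) -> \bar R.
Hypothesis disL : disintegration Lam.
Hypotheses (mX0 : measurable_fun setT X0) (mX1 : measurable_fun setT X1)
  (mZ : measurable_fun setT Z).

Let nneg_indX (A B : set R) : measurable A -> measurable B ->
  nneg (fun u : R * R => (\1_(A `*` B) u)%:E : \bar R).
Proof. by move=> mA mB; apply: nneg_indic; exact: measurableX. Qed.

Let rect : set (set (R * R)) :=
  [set A `*` B | A in measurable & B in measurable].

Let rectI : setI_closed rect.
Proof.
move=> _ _ [X mX [Y mY <-]] [X' mX' [Y' mY' <-]].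
exists (X `&` X'); first exact: measurableI.
by exists (Y `&` Y'); [exact: measurableI|rewrite setXI].
Qed.

Let indXE (A B : set R) (x y : R) :
  (\1_(A `*` B) (x, y))%:E = (\1_A x)%:E * (\1_B y)%:E :> \bar R.
Proof. by rewrite -EFinM !indicE in_setX /= -natrM mulnb. Qed.

Let integral_indM (A : set R) (S : T -> R) (f : T -> \bar R) :
  \int[P]_w ((\1_A (S w))%:E * f w) = \int[P]_(w in S @^-1` A) f w.
Proof.
rewrite [RHS]integral_mkcond; apply: eq_integral => w _.
rewrite patchE indicE.
case: ifPn => [/set_mem Aw|/negP wA]; first by rewrite mem_set ?mul1e.
by rewrite memNset ?mul0e// => Aw; apply: wA; rewrite inE.
Qed.

(** On rectangles this is the disintegration of the law of (X0, X1); both sides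
    are positive functionals of the integrand. *)
Lemma dis_integral (g : R * R -> \bar R) : nneg g ->
  \int[P]_w Lam (X0 w) (fun y => g (X0 w, y)) = \int[P]_w g (X0 w, X1 w).
Proof.
have mX : measurable_fun setT (fun w => (X0 w, X1 w))
  by exact: measurable_fun_pair.
pose Phi (f : R * R -> \bar R) := \int[P]_w Lam (X0 w) (fun y => f (X0 w, y)).
pose Psi (f : R * R -> \bar R) := \int[P]_w f (X0 w, X1 w).
have pPhi : pos_functional Phi.
  apply: pf_integral_family => // [w|f nf].
    have mj : measurable_fun setT (pair (X0 w) : R -> R * R)
      by exact: measurable_pair1.
    exact: pf_comp (dis_pf disL (X0 w)) mj.
  pose h (u : (R * R) * R) := f (u.1.1, u.2).
  have nh : nneg h.
    apply: (nneg_comp (h := fun u : (R * R) * R => (u.1.1, u.2))) => //.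
    apply: measurable_fun_pair => //; first exact: measurableT_comp.
  have mX00 : measurable_fun setT (fun w => (X0 w, 0%R : R)).
    exact: measurable_fun_pair.
  exact: (measurableT_comp (dis_measurable disL nh) mX00).
have pPsi : pos_functional Psi.
  apply: (@pf_integral_family _ _ _ _ _ P setT
    (fun w (f : R * R -> \bar R) => f (X0 w, X1 w))) => // f [_ mf].
  exact: (measurableT_comp mf mX).
have rectE A : rect A ->
    Phi (fun y => (\1_A y)%:E) = Psi (fun y => (\1_A y)%:E).
  move=> [A1 mA1 [A2 mA2 <-]]; rewrite /Phi /Psi.
  transitivity (\int[P]_w ((\1_A1 (X0 w))%:E *
      Lam (X0 w) (fun y => (\1_A2 y)%:E))).
    apply: eq_integral => w _; rewrite -(pfZ (dis_pf disL _)).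
    - by congr Lam; apply/funext => y; rewrite indXE.
    - by rewrite indicE.
    - exact: nneg_indic.
  rewrite integral_indM (dis_law disL) //.
  under [RHS]eq_integral do rewrite indXE.
  rewrite integral_indM integral_indic; [by rewrite setIC| exact: preimageT_measurable..].
have indT : (fun y : R * R => (\1_[set: R * R] y)%:E) = (fun=> 1 : \bar R).
  by apply/funext => y; rewrite indicT.
have rectT : rect setT by exists setT => //; exists setT => //; rewrite setXTT.
move=> ng; apply: (@pf_ext _ _ _ Phi Psi rect) => //.
- by rewrite measurable_prod_measurableType.
- have := rectE _ rectT; rewrite indT => ->; rewrite /Psi integral_cst//.
  by rewrite mul1e (le_lt_trans (probability_le1 _ _)) ?ltry.
- by have := rectE _ rectT; rewrite indT.
Qed.

Variable p : R * R -> R -> R.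
Hypothesis mp : measurable_fun setT (fun u : (R * R) * R => p u.1 u.2).
Hypothesis p0 : forall x z, (0 <= p x z)%R.
Hypothesis plaw : forall A C, measurable A -> measurable C ->
  \int[P]_(w in (fun w => (X0 w, X1 w)) @^-1` A)
     \int[lebesgue_measure]_(z in C) (p (X0 w, X1 w) z)%:E =
  P ((fun w => (X0 w, X1 w)) @^-1` A `&` Z @^-1` C).

(** Numerator of Bayes' formula for the conditional expectation of phi(X1), at
    a point u of the (X0, Z)-plane. *)
Definition dis_num (phi : R -> R) (u : R * R) : \bar R :=
  Lam u.1 (fun y => (phi y * p (u.1, y) u.2)%:E).

Lemma nneg_weighted_density (phi : R -> R) : (forall y, (0 <= phi y)%R) ->
  measurable_fun setT phi ->
  nneg (fun u : (R * R) * R => (phi u.2 * p (u.1.1, u.2) u.1.2)%:E).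
Proof.
move=> phi0 mphi; split => [u|]; first by rewrite lee_fin mulr_ge0.
apply/measurable_EFinP; apply: measurable_funM; first exact: measurableT_comp.
pose s (u : (R * R) * R) := ((u.1.1, u.2), u.1.2).
have ms : measurable_fun setT s.
  apply: measurable_fun_pair; last exact: measurableT_comp.
  apply: measurable_fun_pair => //; exact: measurableT_comp.
exact: (measurableT_comp mp ms).
Qed.

Lemma nneg_weighted_section (phi : R -> R) (u : R * R) :
  (forall y, (0 <= phi y)%R) -> measurable_fun setT phi ->
  nneg (fun y => (phi y * p (u.1, y) u.2)%:E).
Proof.
move=> phi0 mphi.
have mj : measurable_fun setT (pair u : R -> (R * R) * R)
  by exact: measurable_pair1.
exact: (nneg_comp mj (nneg_weighted_density phi0 mphi)).
Qed.

Lemma nneg_dis_num (phi : R -> R) : (forall y, (0 <= phi y)%R) ->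
  measurable_fun setT phi -> nneg (dis_num phi).
Proof.
move=> phi0 mphi; split => [u|].
  by apply: (pf_ge0 (dis_pf disL _)); exact: nneg_weighted_section.
exact: (dis_measurable disL (nneg_weighted_density phi0 mphi)).
Qed.

(** The law of (X0, Z) on the event that X1 lies in B has the density
    [dis_num (\1_B)] with respect to the law of X0 times Lebesgue measure:
    integrate out the second variable of the joint law of (X0, X1, Z), starting
    with rectangles, where the law of Z given (X0, X1) can be used. *)
Lemma dis_num_integral (B : set R) (f : R * R -> R) : measurable B ->
  (forall u, (0 <= f u)%R) -> measurable_fun setT f ->
  \int[P]_w \int[lebesgue_measure]_z
     ((f (X0 w, z))%:E * dis_num (\1_B) (X0 w, z)) =
  \int[P]_(w in X1 @^-1` B) (f (X0 w, Z w))%:E.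
Proof.
move=> mB f0 mf.
have iB0 y : (0 <= \1_B y :> R)%R by rewrite indicE.
have miB : measurable_fun setT (\1_B : R -> R) by exact: measurable_indic.
pose L (u : R * R) (g : R * R -> \bar R) :=
  Lam u.1 (fun y => g u * (\1_B y * p (u.1, y) u.2)%:E).
have pL u : pos_functional (L u).
  apply: (@pf_weight R _ _ _ _ (Lam u.1) (fun=> u)
    (fun y => (\1_B y * p (u.1, y) u.2)%R)) => //.
  - exact: dis_pf.
  - by move=> y; rewrite mulr_ge0.
  - by have [_ /measurable_EFinP] := nneg_weighted_section u iB0 miB.
have nh g : nneg g -> nneg (fun v : (R * R) * R =>
     g v.1 * (\1_B v.2 * p (v.1.1, v.2) v.1.2)%:E).
  by move=> ng; apply: nnegM; [exact: nneg_comp|exact: nneg_weighted_density].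
have nL g : nneg g -> nneg (L ^~ g).
  move=> ng; split => [u|]; first exact: pf_ge0.
  exact: (dis_measurable disL (nh _ ng)).
pose Phi g := \int[P]_w \int[lebesgue_measure]_z L (X0 w, z) g.
pose Psi (g : R * R -> \bar R) := \int[P]_(w in X1 @^-1` B) g (X0 w, Z w).
have mXZ : measurable_fun setT (fun w => (X0 w, Z w))
  by exact: measurable_fun_pair.
have pPhi : pos_functional Phi.
  apply: pf_integral_family => // [w|g ng].
    apply: (@pf_integral_family _ _ _ _ _ lebesgue_measure setT
      (fun z => L (X0 w, z))) => // g ng.
    have mj : measurable_fun setT (pair (X0 w) : R -> R * R)
      by exact: measurable_pair1.
    exact: (measurableT_comp (nL _ ng).2 mj).
  exact: (measurableT_comp (nneg_lebesgue_section (nL _ ng)).2 mX0).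
have pPsi : pos_functional Psi.
  apply: (@pf_integral_family _ _ _ _ _ P (X1 @^-1` B)
    (fun w (f : R * R -> \bar R) => f (X0 w, Z w))) => //;
      first exact: preimageT_measurable.
  by move=> g [_ mg]; exact: (measurableT_comp mg mXZ).
have rectE A : rect A ->
    Phi (fun y => (\1_A y)%:E) = Psi (fun y => (\1_A y)%:E).
  move=> [A1 mA1 [A2 mA2 <-]]; rewrite /Phi /Psi.
  pose g (v : R * R) := \int[lebesgue_measure]_z
     ((\1_(A1 `*` A2) (v.1, z))%:E * (\1_B v.2 * p v z)%:E).
  have nG : nneg (fun v : (R * R) * R =>
      (\1_(A1 `*` A2) (v.1.1, v.2))%:E * (\1_B v.1.2 * p v.1 v.2)%:E).
    apply: nnegM.
      have ms : measurable_fun setT (fun v : (R * R) * R => (v.1.1, v.2)).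
        by apply: measurable_fun_pair => //; exact: measurableT_comp.
      exact: (nneg_comp ms (nneg_indX mA1 mA2)).
    split => [v|]; first by rewrite lee_fin mulr_ge0.
    apply/measurable_EFinP; apply: measurable_funM => //.
    apply: measurableT_comp => //; exact: measurableT_comp.
  have ng : nneg g by exact: (nneg_lebesgue_section nG).
  (* integrate in z first, so that the disintegration of X1 applies to g *)
  transitivity (\int[P]_w Lam (X0 w) (fun y => g (X0 w, y))).
    apply: eq_integral => w _.
    pose h (v : R * R) := (\1_(A1 `*` A2) (X0 w, v.2))%:E *
      (\1_B v.1 * p (X0 w, v.1) v.2)%:E.
    apply: (dis_fubini disL (X0 w) (h := h)).
    pose s (v : R * R) := ((X0 w, v.1), v.2).
    have ms : measurable_fun setT s.
      by apply: measurable_fun_pair => //; apply: measurable_fun_pair.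
    exact: (nneg_comp ms nG).
  rewrite dis_integral// /g.
  transitivity (\int[P]_(w in (fun w => (X0 w, X1 w)) @^-1` (A1 `*` B))
     \int[lebesgue_measure]_(z in A2) (p (X0 w, X1 w) z)%:E).
    rewrite [RHS]integral_mkcond; apply: eq_integral => w _.
    rewrite patchE; case: ifPn => [/set_mem[/= Aw Bw]|/negP wAB].
      rewrite [RHS]integral_mkcond; apply: eq_integral => z _.
      rewrite indXE patchE !indicE (mem_set Aw) (mem_set Bw) mul1e mul1r.
      by case: ifPn => zA; rewrite ?mul1e ?mul0e.
    apply: integral0_eq => z _; rewrite indXE -!EFinM; congr EFin.
    rewrite !indicE; have [Aw|] := boolP (X0 w \in A1); last by rewrite !mul0r.
    have [Bw|] := boolP (X1 w \in B); last by rewrite !mul0r !mulr0.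
    by exfalso; apply: wAB; rewrite inE; split; exact/set_mem.
  rewrite plaw//; last exact: measurableX.
  rewrite (_ : (fun w => _) = (EFin \o \1_(X0 @^-1` A1 `&` Z @^-1` A2)));
    last first.
    by apply/funext => w /=; rewrite !indicE; congr (_%:R%:E); apply/idP/idP;
      rewrite !inE.
  rewrite integral_indic; [|exact: preimageT_measurable|by apply: measurableI; exact: preimageT_measurable].
  congr (P _); apply/seteqP; split => w /=; first by move=> [[]].
  by move=> [[]].
have indT : (fun y : R * R => (\1_[set: R * R] y)%:E) = (fun=> 1 : \bar R).
  by apply/funext => y; rewrite indicT.
have rectT : rect setT by exists setT => //; exists setT => //; rewrite setXTT.
transitivity (Phi (EFin \o f)).
  apply: eq_integral => w _; apply: eq_integral => z _; rewrite /dis_num /L.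
  by rewrite -(pfZ (dis_pf disL _)) //; exact: nneg_weighted_section.
have nf : nneg (EFin \o f).
  by split => [u|]; [rewrite lee_fin|exact/measurable_EFinP].
apply: (@pf_ext _ _ _ Phi Psi rect) => //.
- by rewrite measurable_prod_measurableType.
- have := rectE _ rectT; rewrite indT => ->; rewrite /Psi.
  rewrite integral_cst; last exact: preimageT_measurable.
  rewrite mul1e (le_lt_trans (probability_le1 _ _)) ?ltry//;
    exact: preimageT_measurable.
- by have := rectE _ rectT; rewrite indT.
Qed.

Let XZ w := (X0 w, Z w).

Let mXZ : measurable_fun setT XZ.
Proof. exact: measurable_fun_pair. Qed.

Definition marginal := dis_num (fun=> 1%R).

(** As [fine] sends infinity to 0 and the inverse of 0 is 0, this vanishes
    exactly outside the set where the marginal density is positive and finite,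
    so no case distinction is needed to make Bayes' quotient measurable. *)
Definition inv_marginal (u : R * R) : R := (fine (marginal u))^-1.

Lemma nneg_marginal : nneg marginal.
Proof. exact: nneg_dis_num. Qed.

Lemma inv_marginal_ge0 u : (0 <= inv_marginal u)%R.
Proof. by rewrite invr_ge0 fine_ge0//; exact: nneg_marginal.1. Qed.

Lemma measurable_inv_marginal : measurable_fun setT inv_marginal.
Proof.
have -> : inv_marginal = (fun r : R => r `^ (-1))%R \o (fine \o marginal).
  apply/funext => u /=; rewrite powR_inv1// fine_ge0//; exact: nneg_marginal.1.
apply: measurableT_comp; first exact: measurable_powR.
apply: measurableT_comp; first exact: fine_measurable.
by have [] := nneg_marginal.
Qed.

Lemma law_XZ (f : R * R -> R) : (forall u, (0 <= f u)%R) ->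
  measurable_fun setT f ->
  \int[P]_w \int[lebesgue_measure]_z ((f (X0 w, z))%:E * marginal (X0 w, z)) =
  \int[P]_w (f (XZ w))%:E.
Proof.
move=> f0 mf.
have := dis_num_integral measurableT f0 mf.
by rewrite preimage_setT indicT.
Qed.

Lemma probability_XZ (E : set (R * R)) : measurable E ->
  \int[P]_w \int[lebesgue_measure]_z ((\1_E (X0 w, z))%:E * marginal (X0 w, z)) =
  P (XZ @^-1` E).
Proof.
move=> mE; rewrite law_XZ//.
by rewrite (integral_indic _ measurableT (preimageT_measurable mXZ mE)) setIT.
Qed.

Let ae_XZ (E : set (R * R)) : measurable E -> P (XZ @^-1` E) = 0 ->
  {ae P, forall w, ~ E (XZ w)}.
Proof.
move=> mE E0; exists (XZ @^-1` E); split => //;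
  first exact: preimageT_measurable.
by move=> w /= /contrapT.
Qed.

(** The law of (X0, Z) has this density, so it does not charge its zero set. *)
Lemma marginal_gt0 : {ae P, forall w, 0 < marginal (XZ w)}.
Proof.
pose E := [set u | marginal u = 0].
have mE : measurable E.
  rewrite -[E]setTI; apply: measurable_eqe => //; first exact: nneg_marginal.2.
have PE : P (XZ @^-1` E) = 0.
  rewrite -probability_XZ//; apply: integral0_eq => w _.
  apply: integral0_eq => z _; rewrite indicE.
  by have [/set_mem ->|] := boolP (_ \in E); rewrite ?mule0 ?mul0e.
apply: filterS (ae_XZ mE PE) => w /eqP nE.
by rewrite lt_neqAle eq_sym nE nneg_marginal.1.
Qed.

(** Where the density is infinite, doubling the integrand does not change it;
    so the probability of that set is twice itself. *)
Lemma marginal_lty : {ae P, forall w, marginal (XZ w) < +oo}.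
Proof.
pose E := [set u | marginal u = +oo].
have mE : measurable E.
  rewrite -[E]setTI; apply: measurable_eqe => //; first exact: nneg_marginal.2.
have PE : P (XZ @^-1` E) = 0.
  have : P (XZ @^-1` E) = 2%:E * P (XZ @^-1` E).
    rewrite -[in LHS]probability_XZ//.
    transitivity (\int[P]_w \int[lebesgue_measure]_z
        ((2 * \1_E (X0 w, z))%:E * marginal (X0 w, z))).
      apply: eq_integral => w _; apply: eq_integral => z _; rewrite indicE.
      have [/set_mem ->|] := boolP (_ \in E); last by rewrite mulr0.
      by rewrite mulr1 !gt0_muley ?lte_fin.
    rewrite (law_XZ (f := fun u => 2 * \1_E u)%R); last 2 first.
    - by move=> u; rewrite mulr_ge0// indicE.
    - by apply: measurable_funM => //; exact: measurable_indic.
    under eq_integral do rewrite EFinM.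
    have mEX := preimageT_measurable mXZ mE.
    rewrite ge0_integralZl//.
    - by rewrite (integral_indic _ measurableT mEX) setIT.
    - by apply/measurable_EFinP; exact: (measurable_indic mEX).
  rewrite -[P _]fineK ?fin_num_measure//; last exact: preimageT_measurable.
  by rewrite -EFinM => -[] e; congr EFin; lra.
apply: filterS (ae_XZ mE PE) => w /eqP nE.
by rewrite ltey.
Qed.

Lemma dis_num_indic_le (B : set R) u : measurable B ->
  dis_num (\1_B) u <= marginal u.
Proof.
move=> mB; have iB0 y : (0 <= \1_B y :> R)%R by rewrite indicE.
apply: (pf_le (dis_pf disL _)).
- by apply: (nneg_weighted_section u iB0); exact: measurable_indic.
- by apply: (nneg_weighted_section u) => // y; exact: ler01.
- by move=> y; rewrite lee_fin ler_wpM2r// indicE lern1 leq_b1.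
Qed.

Definition bayes (B : set R) (u : R * R) : R :=
  inv_marginal u * fine (dis_num (\1_B) u).

Lemma bayes_ge0 B u : measurable B -> (0 <= bayes B u)%R.
Proof.
move=> mB; rewrite mulr_ge0 ?inv_marginal_ge0// fine_ge0//.
by apply: (nneg_dis_num _ _).1 => [y|]; [rewrite indicE|exact: measurable_indic].
Qed.

Lemma measurable_bayes B : measurable B -> measurable_fun setT (bayes B).
Proof.
move=> mB; apply: measurable_funM; first exact: measurable_inv_marginal.
apply: measurableT_comp; first exact: fine_measurable.
by apply: (nneg_dis_num _ _).2 => [y|]; [rewrite indicE|exact: measurable_indic].
Qed.

Lemma bayesE B : measurable B -> {ae P, forall w,
  (bayes B (XZ w))%:E = (inv_marginal (XZ w))%:E * dis_num (\1_B) (XZ w)}.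
Proof.
move=> mB; apply: filterS marginal_lty => w qy.
rewrite /bayes EFinM fineK// ge0_fin_numE.
  by apply: le_lt_trans qy; exact: dis_num_indic_le.
by apply: (nneg_dis_num _ _).1 => [y|]; [rewrite indicE|exact: measurable_indic].
Qed.

(** Multiplying the quotient by the density of (X0, Z) gives back the numerator
    on the set H where the density is positive and finite, and 0 outside; the
    point (X0, Z) lies in H almost surely. *)
Lemma integral_bayes B S : measurable B -> measurable S ->
  \int[P]_(w in XZ @^-1` S) (bayes B (XZ w))%:E =
  P (XZ @^-1` S `&` X1 @^-1` B).
Proof.
move=> mB mS.
have [mq q0] : measurable_fun setT marginal /\ (forall u, 0 <= marginal u).
  by have [] := nneg_marginal.
pose H := [set u | 0 < marginal u] `&` [set u | marginal u < +oo].
have mH : measurable H.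
  apply: measurableI; rewrite -[X in measurable X]setTI;
  by apply: measurable_lte => //; exact: measurable_cst.
have aeH : {ae P, forall w, H (XZ w)}.
  by apply: filterS2 marginal_gt0 marginal_lty.
have iB0 y : (0 <= \1_B y :> R)%R by rewrite indicE.
have miB : measurable_fun setT (\1_B : R -> R) by exact: measurable_indic.
transitivity (\int[P]_w (\1_S (XZ w) * bayes B (XZ w))%:E).
  rewrite integral_mkcond; apply: eq_integral => w _.
  rewrite patchE indicE; case: ifPn => [/set_mem Sw|/negP Sw].
    by rewrite mem_set ?mul1r.
  by rewrite memNset ?mul0r// => ?; apply: Sw; rewrite inE.
have f0 u : (0 <= \1_S u * bayes B u)%R by rewrite mulr_ge0 ?bayes_ge0// indicE.
have mf : measurable_fun setT (fun u => \1_S u * bayes B u)%R.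
  by apply: measurable_funM; [exact: measurable_indic|exact: measurable_bayes].
rewrite -(law_XZ f0 mf).
have g0 u : (0 <= \1_(S `&` H) u :> R)%R by rewrite indicE.
have mg : measurable_fun setT (\1_(S `&` H) : R * R -> R).
  by apply: measurable_indic; exact: measurableI.
transitivity (\int[P]_w \int[lebesgue_measure]_z
    ((\1_(S `&` H) (X0 w, z))%:E * dis_num (\1_B) (X0 w, z))).
  apply: eq_integral => w _; apply: eq_integral => z _.
  set u := (X0 w, z); rewrite indicI /= EFinM [in RHS]EFinM -!muleA; congr (_ * _).
  rewrite indicE; have [/set_mem[q_gt0 q_lty]|nH] := boolP (u \in H).
    have qfin : marginal u \is a fin_num by rewrite ge0_fin_numE.
    have Nfin : dis_num (\1_B) u \is a fin_num.
      rewrite ge0_fin_numE; last exact: (nneg_dis_num iB0 miB).1.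
      by apply: le_lt_trans q_lty; exact: dis_num_indic_le.
    rewrite mul1e -[in LHS](fineK qfin) -EFinM -[RHS](fineK Nfin); congr EFin.
    rewrite /bayes /inv_marginal mulrAC mulVf ?mul1r//.
    by rewrite gt_eqF// fine_gt0// q_gt0 q_lty.
  rewrite mul0e; have [q_gt0|] := boolP (0 < marginal u).
    have [q_lty|] := boolP (marginal u < +oo).
      by exfalso; move/negP : nH; apply; rewrite inE.
    by rewrite -leNgt leye_eq /bayes /inv_marginal => /eqP ->;
      rewrite /= invr0 mul0r mul0e.
  by rewrite -leNgt => q_le0; rewrite (_ : marginal u = 0) ?mule0//; apply/eqP;
    rewrite eq_le q_le0 q0.
rewrite (dis_num_integral mB g0 mg).
have mSH : measurable (XZ @^-1` (S `&` H))
  by apply: (preimageT_measurable mXZ); exact: measurableI.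
rewrite (integral_indic _ (preimageT_measurable mX1 mB) mSH).
have mHX := preimageT_measurable mXZ mH.
have PH : P (~` (XZ @^-1` H)) = 0.
  apply: measure_negligible; first exact: measurableC.
  by move: aeH; apply: filterS.
have mSB : measurable (XZ @^-1` S `&` X1 @^-1` B).
  by apply: measurableI; [exact: preimageT_measurable|exact: preimageT_measurable].
rewrite [RHS](measureDI P mSB mHX).
rewrite [X in X + _](_ : _ = 0); last first.
  apply: subset_measure0 PH; [exact: measurableD|exact: measurableC|].
  by move=> w [].
by rewrite add0e; congr (P _); apply/seteqP; split => w [[? ?] ?].
Qed.

(** From here on, [F] is the past: it contains the sigma-algebra of (X0, Z),
    and [markov] says that the two have a common version of the conditional
    probabilities of X1. *)
Variable F : set (set T).
Hypotheses (sF : sigma_algebra setT F) (Fm : F `<=` measurable)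
  (XZF : sigma_of XZ `<=` F).
Hypothesis markov : forall B, measurable B -> exists Y,
  is_cond_prob P F (X1 @^-1` B) Y /\ is_cond_prob P (sigma_of XZ) (X1 @^-1` B) Y.

Let kappa := bayes.
Let rho := inv_marginal.

Let sigma_XZ : sigma_algebra setT (sigma_of XZ).
Proof. exact/sigma_algebra_preimage/sigma_algebra_measurable. Qed.

Let sigma_XZ_comp (g : R * R -> \bar R) : measurable_fun setT g ->
  sigma_of (g \o XZ) `<=` sigma_of XZ.
Proof.
move=> mg _ [B mB <-]; exists (g @^-1` B) => //.
by rewrite -[X in measurable X]setTI; exact: mg.
Qed.

Lemma bayes_cond_prob B : measurable B ->
  is_cond_prob P (sigma_of XZ) (X1 @^-1` B) (fun w => (kappa B (XZ w))%:E).
Proof.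
move=> mB.
have mk : measurable_fun setT (kappa B) by exact: (measurable_bayes mB).
have mkXZ : measurable_fun setT (fun w => (kappa B (XZ w))%:E).
  by apply/measurable_EFinP; exact: measurableT_comp.
have intk := integral_bayes mB.
split.
- by apply: (@sigma_XZ_comp (EFin \o kappa B)); exact/measurable_EFinP.
- apply/integrableP; split => //.
  under eq_integral do rewrite gee0_abs ?lee_fin ?(bayes_ge0 _ mB)//.
  have := intk _ measurableT; rewrite preimage_setT => ->.
  rewrite (le_lt_trans (probability_le1 _ _)) ?ltry// setTI;
    exact: preimageT_measurable.
- move=> _ [S mS <-]; rewrite setTI [LHS]intk//.
  have mB1 : measurable (X1 @^-1` B) by exact: preimageT_measurable.
  by rewrite (integral_indic _ (preimageT_measurable mXZ mS) mB1) setIC.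
Qed.

(** The common version provided by the Markov property is almost surely Bayes'
    quotient, because the latter is a version for the smaller sigma-algebra;
    being also a version for the larger one, it can be tested on [F]. *)
Lemma bayes_filter A B : F A -> measurable B ->
  \int[P]_(w in A) (kappa B (XZ w))%:E = P (A `&` X1 @^-1` B).
Proof.
move=> FA mB; have [Y [[_ iY eY] YG]] := markov mB.
have mA := Fm FA.
have mk : measurable_fun setT (fun w => (kappa B (XZ w))%:E).
  apply/measurable_EFinP; apply: measurableT_comp mXZ.
  exact: (measurable_bayes mB).
have GM : sigma_of XZ `<=` measurable by move=> A' /XZF /Fm.
have ae := cond_exp_unique sigma_XZ GM (bayes_cond_prob mB) YG.
rewrite (@ae_eq_integral _ _ _ P A Y)//.
- rewrite eY// integral_indic//; first by rewrite setIC.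
  exact: preimageT_measurable.
- exact: measurable_funTS.
- by apply: measurable_funTS; have /integrableP[] := iY.
- by apply: filterS ae => w e _.
Qed.

(** For a fixed event of [F], both sides are positive functionals of phi, and
    they agree on indicators. *)
Lemma filter_nneg (phi : R -> R) A : (forall y, (0 <= phi y)%R) ->
  measurable_fun setT phi -> F A ->
  \int[P]_(w in A) ((rho (XZ w))%:E * dis_num phi (XZ w)) =
  \int[P]_(w in A) (phi (X1 w))%:E.
Proof.
move=> phi0 mphi FA; have mA := Fm FA.
have rho0 u : (0 <= rho u)%R by exact: (inv_marginal_ge0).
have mrho : measurable_fun setT rho := measurable_inv_marginal.
pose L w (g : R -> \bar R) :=
  Lam (X0 w) (fun y => g y * (rho (XZ w) * p (X0 w, y) (Z w))%:E).
have nrp : nneg (fun v : (R * R) * R => (rho v.1 * p (v.1.1, v.2) v.1.2)%:E).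
  split => [v|]; first by rewrite lee_fin mulr_ge0.
  apply/measurable_EFinP; apply: measurable_funM; first exact: measurableT_comp.
  have m1 : measurable_fun setT (fun _ : R => 1%R : R) by exact: measurable_cst.
  have [_ /measurable_EFinP] := nneg_weighted_density (fun=> ler01) m1.
  by under [X in measurable_fun _ X]eq_fun do rewrite mul1r.
have pL w : pos_functional (L w).
  apply: (@pf_weight R _ _ _ _ (Lam (X0 w)) id
    (fun y => rho (XZ w) * p (X0 w, y) (Z w))%R).
  - exact: (dis_pf disL (X0 w)).
  - exact: measurable_id.
  - by move=> y; rewrite mulr_ge0.
  - have mj : measurable_fun setT (pair (XZ w) : R -> (R * R) * R) by exact: measurable_pair1.
    by have [_ /measurable_EFinP] := nneg_comp mj nrp.
have mL g : nneg g -> measurable_fun setT (L ^~ g).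
  move=> ng.
  have nh : nneg (fun v : (R * R) * R =>
      g v.2 * (rho v.1 * p (v.1.1, v.2) v.1.2)%:E).
    by apply: nnegM => //; exact: nneg_comp.
  exact: (measurableT_comp (dis_measurable disL nh) mXZ).
pose Phi g := \int[P]_(w in A) L w g.
pose Psi (g : R -> \bar R) := \int[P]_(w in A) g (X1 w).
have pPhi : pos_functional Phi by exact: pf_integral_family.
have pPsi : pos_functional Psi.
  apply: (@pf_integral_family _ _ _ _ _ P A
    (fun w (f : R -> \bar R) => f (X1 w))) => // g [_ mg].
  exact: measurableT_comp.
have LE w (f : R -> R) : (forall y, (0 <= f y)%R) -> measurable_fun setT f ->
    L w (EFin \o f) = (rho (XZ w))%:E * dis_num f (XZ w).
  move=> f0 mf; rewrite -(pfZ (dis_pf disL _)) //; last first.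
    exact: (nneg_weighted_section (XZ w)).
  by congr Lam; apply/funext => y; rewrite /= -!EFinM mulrCA.
have indE B : measurable B ->
    Phi (fun y => (\1_B y)%:E) = Psi (fun y => (\1_B y)%:E).
  move=> mB; have mB1 : measurable (X1 @^-1` B) by exact: preimageT_measurable.
  have -> : Psi (fun y => (\1_B y)%:E) = P (A `&` X1 @^-1` B).
    by rewrite /Psi (integral_indic _ mA mB1) setIC.
  rewrite -bayes_filter//.
  have iB0 y : (0 <= \1_B y :> R)%R by rewrite indicE.
  have miB : measurable_fun setT (\1_B : R -> R) by exact: measurable_indic.
  apply: ge0_ae_eq_integral => //.
  - by apply: measurable_funTS; apply: mL; exact: nneg_indic.
  - apply: measurable_funTS; apply/measurable_EFinP;
    apply: measurableT_comp mXZ.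
    exact: (measurable_bayes mB).
  - by move=> w _; apply: pf_ge0 => //; exact: nneg_indic.
  - by move=> w _; rewrite lee_fin (bayes_ge0).
  - apply: filterS (bayesE mB) => w e _.
    by rewrite e -LE.
have indT : (fun y : R => (\1_[set: R] y)%:E) = (fun=> 1 : \bar R).
  by apply/funext => y; rewrite indicT.
transitivity (Phi (EFin \o phi)).
  by apply: eq_integral => w _; rewrite LE.
apply: (@pf_ext _ _ _ Phi Psi measurable) => //.
- exact: measurableI.
- by rewrite sigma_algebra_id//; exact: sigma_algebra_measurable.
- have := indE _ measurableT; rewrite indT => ->; rewrite /Psi integral_cst//.
  by rewrite mul1e (le_lt_trans (probability_le1 _ _)) ?ltry.
- by have := indE _ measurableT; rewrite indT.
- by split => [y|]; [rewrite lee_fin|exact/measurable_EFinP].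
Qed.

Hypothesis iX1 : P.-integrable setT (EFin \o X1).
Variable M : T -> R.
Hypothesis condM : is_cond_exp P F (EFin \o X1) (EFin \o M).

Let pos (y : R) : R := Num.max y 0%R.
Let neg (y : R) : R := Num.max (- y)%R 0%R.

Let pos0 y : (0 <= pos y)%R. Proof. by rewrite le_max lexx orbT. Qed.
Let neg0 y : (0 <= neg y)%R. Proof. by rewrite le_max lexx orbT. Qed.
Let mpos : measurable_fun setT pos.
Proof. by apply: measurable_maxr => //; exact: measurable_id. Qed.
Let mneg : measurable_fun setT neg.
Proof. by apply: measurable_maxr => //; exact: measurable_oppr. Qed.

Let FT : F setT. Proof. by apply: XZF; exists setT => //;
  rewrite preimage_setT setTI. Qed.

Let weight (phi : R -> R) u : R := rho u * fine (dis_num phi u).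

Let mnum (phi : R -> R) : (forall y, (0 <= phi y)%R) -> measurable_fun setT phi ->
  measurable_fun setT (dis_num phi).
Proof. by move=> h1 h2; have [] := nneg_dis_num h1 h2. Qed.

Let num0 (phi : R -> R) u : (forall y, (0 <= phi y)%R) -> measurable_fun setT phi ->
  0 <= dis_num phi u.
Proof. by move=> h1 h2; have [] := nneg_dis_num h1 h2. Qed.

(** The expectation of the quotient is that of phi(X1), so the quotient is
    finite, and its denominator is positive and finite. *)
Let num_fin (phi : R -> R) : (forall y, (0 <= phi y)%R) ->
  measurable_fun setT phi -> P.-integrable setT (fun w => (phi (X1 w))%:E) ->
  {ae P, forall w, dis_num phi (XZ w) \is a fin_num}.
Proof.
move=> phi0 mphi iphi.
have rho0 u : (0 <= rho u)%R by exact: (inv_marginal_ge0).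
have mrho : measurable_fun setT rho := measurable_inv_marginal.
have irho : P.-integrable setT
    (fun w => (rho (XZ w))%:E * dis_num phi (XZ w)).
  apply/integrableP; split.
    apply: emeasurable_funM.
      by apply/measurable_EFinP; exact: measurableT_comp.
    by apply: (measurableT_comp _ mXZ); exact: mnum.
  under eq_integral do rewrite gee0_abs ?mule_ge0 ?lee_fin ?num0//.
  rewrite filter_nneg//.
  have /integrableP[_] := iphi.
  by under eq_integral do rewrite gee0_abs ?lee_fin//.
apply: filterS3 (integrable_ae measurableT irho)
  (marginal_gt0)
  (marginal_lty) => w /(_ I) fin q0 qy.
rewrite ge0_fin_numE ?num0// ltey; apply: contraTN fin => /eqP ->.
rewrite gt0_muley// lte_fin /rho /inv_marginal invr_gt0 fine_gt0//.
by rewrite q0 qy.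
Qed.

Let weightE (phi : R -> R) : (forall y, (0 <= phi y)%R) ->
  measurable_fun setT phi -> P.-integrable setT (fun w => (phi (X1 w))%:E) ->
  P.-integrable setT (fun w => (weight phi (XZ w))%:E) /\
  forall A, F A -> \int[P]_(w in A) (weight phi (XZ w))%:E =
    \int[P]_(w in A) (phi (X1 w))%:E.
Proof.
move=> phi0 mphi iphi.
have rho0 u : (0 <= rho u)%R by exact: (inv_marginal_ge0).
have mrho : measurable_fun setT rho := measurable_inv_marginal.
have mw : measurable_fun setT (fun w => (weight phi (XZ w))%:E).
  apply/measurable_EFinP; apply: (measurableT_comp _ mXZ).
  apply: measurable_funM => //; apply: measurableT_comp;
    first exact: fine_measurable.
  exact: mnum.
have w0 u : (0 <= weight phi u)%R by rewrite mulr_ge0// fine_ge0// num0.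
have iw A : F A -> \int[P]_(w in A) (weight phi (XZ w))%:E =
    \int[P]_(w in A) (phi (X1 w))%:E.
  move=> FA; have mA := Fm FA; rewrite -filter_nneg//.
  apply: ge0_ae_eq_integral => //.
  - exact: measurable_funTS.
  - apply: measurable_funTS; apply: emeasurable_funM.
      by apply/measurable_EFinP; exact: measurableT_comp.
    by apply: (measurableT_comp _ mXZ); exact: mnum.
  - by move=> w _; rewrite lee_fin.
  - by move=> w _; rewrite mule_ge0 ?lee_fin ?num0.
  - apply: filterS (num_fin phi0 mphi iphi) => w fin _.
    by rewrite /weight EFinM fineK.
split => //; apply/integrableP; split => //.
under eq_integral do rewrite gee0_abs ?lee_fin//.
rewrite iw//; have /integrableP[_] := iphi.
by under eq_integral do rewrite gee0_abs ?lee_fin//.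
Qed.

Let ipos : P.-integrable setT (fun w => (pos (X1 w))%:E).
Proof.
have := integrable_funepos measurableT iX1; congr (_.-integrable _ _).
by apply/funext => w; rewrite funeposE EFin_max.
Qed.

Let ineg : P.-integrable setT (fun w => (neg (X1 w))%:E).
Proof.
have := integrable_funeneg measurableT iX1; congr (_.-integrable _ _).
by apply/funext => w; rewrite funenegE EFin_max.
Qed.

(** The numerator is split into the integrals against the positive and the
    negative part of y, both finite, so that the formula makes sense for
    functionals that only act on nonnegative functions. *)
Theorem bayes_formula : {ae P, forall w,
  let Np := Lam (X0 w) (fun y => (Num.max y 0%R * p (X0 w, y) (Z w))%:E) in
  let Nm := Lam (X0 w) (fun y => (Num.max (- y)%R 0%R * p (X0 w, y) (Z w))%:E) in
  let D := Lam (X0 w) (fun y => (p (X0 w, y) (Z w))%:E) in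
  [/\ Np \is a fin_num, Nm \is a fin_num, D \is a fin_num, D != 0 &
      M w = ((fine Np - fine Nm) / fine D)%R]}.
Proof.
have [iwp ewp] := weightE pos0 mpos ipos.
have [iwm ewm] := weightE neg0 mneg ineg.
pose W w := (weight pos (XZ w) - weight neg (XZ w))%R.
have condW : is_cond_exp P F (EFin \o X1) (EFin \o W).
  split.
  - apply: subset_trans XZF.
    apply: (@sigma_XZ_comp (fun u => (weight pos u - weight neg u)%:E)).
    have mw (phi : R -> R) : (forall y, (0 <= phi y)%R) -> measurable_fun setT phi ->
        measurable_fun setT (weight phi).
      move=> h1 h2; apply: measurable_funM.
        exact: (measurable_inv_marginal).
      apply: measurableT_comp; first exact: fine_measurable.
      exact: mnum.
    by apply/measurable_EFinP; apply: measurable_funB; exact: mw.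
  - by have := integrableB measurableT iwp iwm.
  - move=> A FA; have mA := Fm FA.
    have iA (Y : T -> \bar R) : P.-integrable setT Y -> P.-integrable A Y.
      by move=> iY; exact: (integrableS measurableT mA).
    transitivity (\int[P]_(w in A) ((weight pos (XZ w))%:E - (weight neg (XZ w))%:E)).
      by apply: eq_integral => w _; rewrite -EFinB.
    rewrite integralB//; try exact: iA.
    rewrite ewp// ewm// [RHS]integralE; congr (_ - _); apply: eq_integral => w _.
    + by rewrite funeposE EFin_max.
    + by rewrite funenegE EFin_max.
have aeM := cond_exp_unique sF Fm condM condW.
have aeq : {ae P, forall w,
    0 < marginal (XZ w) /\ marginal (XZ w) < +oo}.
  apply: filterI; first exact: (marginal_gt0).
  exact: (marginal_lty).
have aeN : {ae P, forall w, dis_num pos (XZ w) \is a fin_num /\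
    dis_num neg (XZ w) \is a fin_num}.
  by apply: filterI; [exact: num_fin pos0 mpos ipos|exact: num_fin neg0 mneg ineg].
apply: filterS3 aeM aeq aeN => w /= [eM] [q0 qy] [Np Nm].
have DE : Lam (X0 w) (fun y => (p (X0 w, y) (Z w))%:E) = marginal (XZ w).
  by congr Lam; apply/funext => y; rewrite mul1r.
rewrite DE; split => //.
- by rewrite ge0_fin_numE// ltW.
- by rewrite gt_eqF.
- by rewrite eM /W /weight -mulrBr mulrC.
Qed.

End Disintegration.

(** * Disintegrations given by distribution functions and by densities *)

Section StieltjesDisintegration.
Local Open Scope ereal_scope.
Context {R : realType}.

Definition rays : set (set R) := range (fun y : R => `]-oo, y]%classic).

Lemma raysI : setI_closed rays.
Proof.
move=> _ _ [x _ <-] [y _ <-]; exists (Num.min x y) => //.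
by apply/seteqP; split => z /=; rewrite !in_itv/= le_min => /andP.
Qed.

Lemma measurable_rays : measurable = <<s rays >>.
Proof.
apply/seteqP; split.
  rewrite [measurable]RGenOInfty.measurableE; apply: smallest_sub.
    exact: smallest_sigma_algebra.
  move=> _ [x ->]; rewrite -setCitvl -setTD.
  apply: sigma_algebraCD; apply: sub_sigma_algebra; by exists x.
apply: smallest_sub; first exact: sigma_algebra_measurable.
by move=> _ [y _ <-]; exact: measurable_itv.
Qed.

Lemma lebesgue_stieltjes_ray (G : cumulativeBounded (0 : R) (1 : R)) (y : R) :
  lebesgue_stieltjes_measure G `]-oo, y]%classic = (G y)%:E.
Proof. by have := cdf_lebesgue_stieltjes_id G y. Qed.

Variable F : R -> cumulativeBounded (0 : R) (1 : R).
Hypothesis mF : forall y, measurable_fun setT (fun x => F x y).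

(** The kernel ignores its second parameter, which only serves to obtain the
    joint measurability required of a disintegration. *)
Definition ls_kernel (u : R * R) : {measure set (measurableTypeR R) -> \bar R} :=
  lebesgue_stieltjes_measure (F u.1).

(** The measure of a ray is a value of the distribution function; the other
    Borel sets follow by the pi-lambda theorem. *)
Lemma measurable_ls_kernel U : measurable U ->
  measurable_fun setT (ls_kernel ^~ U).
Proof.
pose H := [set A : set R | measurable A /\ measurable_fun setT (ls_kernel ^~ A)].
suff : @measurable _ R `<=` H by move=> h /h[].
rewrite measurable_rays; apply: lambda_system_subset => //; first exact: raysI.
  split => //.
  - split => //; rewrite (_ : (fun u => _) = (fun=> 1)).
      exact: measurable_cst.
    by apply/funext => u; exact: probability_setT.
  - move=> A B BA [mA eA] [mB eB]; split; first exact: measurableD.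
    rewrite (_ : (fun u => _) = (fun u => ls_kernel u A - ls_kernel u B)).
      exact: emeasurable_funB.
    apply/funext => u; rewrite measureD//; last first.
      have := @probability_le1 _ _ _ (lebesgue_stieltjes_measure (F u.1)) A mA.
      by move=> /le_lt_trans; apply; exact: ltry.
    by rewrite setIidr.
  - move=> A ndA HA; have mA n : measurable (A n) by have [] := HA n.
    have mU : measurable (\bigcup_n A n) by exact: bigcup_measurable.
    split => //; apply: (emeasurable_fun_cvg (fun n u => ls_kernel u (A n))).
      by move=> n; have [] := HA n.
    move=> u _; by apply: nondecreasing_cvg_mu => //; exact: mU.
move=> _ [y _ <-]; split; first exact: measurable_itv.
rewrite (_ : (fun u => _) = (fun u : R * R => (F u.1 y)%:E)).
  apply/measurable_EFinP; exact: (measurableT_comp (mF y)).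
by apply/funext => u; rewrite /ls_kernel /= lebesgue_stieltjes_ray.
Qed.

HB.instance Definition _ := isKernel.Build _ _ _ _ _ ls_kernel measurable_ls_kernel.

Lemma ls_kernelT u : ls_kernel u setT = 1.
Proof. exact: probability_setT. Qed.

HB.instance Definition _ := Kernel_isProbability.Build _ _ _ _ _ ls_kernel ls_kernelT.

Definition stieltjes_family (x : R) (h : R -> \bar R) : \bar R :=
  \int[lebesgue_stieltjes_measure (F x)]_y h y.

Lemma measurable_stieltjes_family (h : (R * R) * R -> \bar R) : nneg h ->
  measurable_fun setT (fun u : R * R => stieltjes_family u.1 (fun y => h (u, y))).
Proof.
move=> [h0 mh].
pose h' : (R * R) * measurableTypeR R -> \bar R := h.
have mh' : measurable_fun setT h' by exact: mh.
have := @measurable_fun_integral_finite_kernel _ _ _ _ _ h' ls_kernel h0 mh'.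
exact.
Qed.

Lemma disintegration_stieltjes d (T : measurableType d) (P : probability T R)
    (X0 X1 : T -> R) :
  measurable_fun setT X0 -> measurable_fun setT X1 ->
  (forall A y, measurable A ->
    \int[P]_(w in X0 @^-1` A) (F (X0 w) y)%:E =
    P (X0 @^-1` A `&` X1 @^-1` `]-oo, y])) ->
  disintegration P X0 X1 stieltjes_family.
Proof.
move=> mX0 mX1 law.
have mid : measurable_fun setT (id : measurableTypeR R -> R)
  := @measurable_id _ _ setT.
have pf x : pos_functional (stieltjes_family x).
  exact: (pf_comp (pf_integral (lebesgue_stieltjes_measure (F x))) mid).
split => //.
- exact: measurable_stieltjes_family.
- move=> x h [h0 mh].
  by have := @fubini_tonelli _ _ _ _ _ (lebesgue_stieltjes_measure (F x))
    (@lebesgue_measure R) h mh h0.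
- move=> A B mA mB; have mA0 := preimageT_measurable mX0 mA.
  pose Phi h := \int[P]_(w in X0 @^-1` A) stieltjes_family (X0 w) h.
  pose Psi (h : R -> \bar R) := \int[P]_(w in X0 @^-1` A) h (X1 w).
  have pPhi : pos_functional Phi.
    apply: pf_integral_family => // h nh.
    have nh' : nneg (fun v : (R * R) * R => h v.2) by exact: nneg_comp nh.
    have mX00 : measurable_fun setT (fun w => (X0 w, 0%R : R)).
      exact: measurable_fun_pair.
    exact: (measurableT_comp (measurable_stieltjes_family nh') mX00).
  have pPsi : pos_functional Psi.
    apply: (@pf_integral_family _ _ _ _ _ P (X0 @^-1` A)
      (fun w (f : R -> \bar R) => f (X1 w))) => // g [_ mg].
    exact: measurableT_comp.
  have Psi_indic B' : measurable B' ->
      Psi (fun y => (\1_B' y)%:E) = P (X0 @^-1` A `&` X1 @^-1` B').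
    by move=> mB';
      rewrite /Psi (integral_indic _ mA0 (preimageT_measurable mX1 mB')) setIC.
  have Phi1 : Phi (fun=> 1) = P (X0 @^-1` A).
    transitivity (\int[P]_(w in X0 @^-1` A) (cst 1 w : \bar R)).
      apply: eq_integral => w _; rewrite /stieltjes_family integral_cst//.
      by rewrite mul1e; exact: (ls_kernelT (X0 w, 0%R)).
    by rewrite integral_cst// mul1e.
  rewrite -Psi_indic//.
  apply: (@pf_ext_indic _ _ _ Phi Psi rays) => //.
  + exact: raysI.
  + exact: measurable_rays.
  + by rewrite Phi1 (le_lt_trans (probability_le1 _ _)) ?ltry.
  + by rewrite Phi1 /Psi integral_cst// mul1e.
  + move=> _ [y _ <-]; rewrite Psi_indic// -law//; apply: eq_integral => w _.
    have my : measurable (`]-oo, y]%classic : set (measurableTypeR R)).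
      exact: measurable_itv.
    rewrite /stieltjes_family (integral_indic _ measurableT my) setIT.
    exact: lebesgue_stieltjes_ray.
Qed.

End StieltjesDisintegration.

Section DensityDisintegration.
Local Open Scope ereal_scope.
Context {R : realType} {dE : measure_display} {E : measurableType dE}.
Variables (m : {sigma_finite_measure set E -> \bar R}) (g : E -> R)
  (k : R -> E -> R).
Hypotheses (mg : measurable_fun setT g)
  (mk : measurable_fun setT (fun u : R * E => k u.1 u.2))
  (k0 : forall x e, (0 <= k x e)%R).

Definition density_family (x : R) (h : R -> \bar R) : \bar R :=
  \int[m]_e (h (g e) * (k x e)%:E).

(** The map [g] from the space that carries the reference measure to the values
    of X1 lets the same statement cover Lebesgue densities (with the identity)
    and discrete laws (with an enumeration of the atoms). *)
Lemma disintegration_density d (T : measurableType d) (P : probability T R)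
    (X0 X1 : T -> R) :
  (forall A B, measurable A -> measurable B ->
    \int[P]_(w in X0 @^-1` A) \int[m]_e (\1_B (g e) * k (X0 w) e)%:E =
    P (X0 @^-1` A `&` X1 @^-1` B)) ->
  disintegration P X0 X1 density_family.
Proof.
move=> law.
have mkx x : measurable_fun setT (k x).
  have mj : measurable_fun setT (pair x : E -> R * E)
    by exact: measurable_pair1.
  exact: (measurableT_comp mk mj).
split.
- by move=> x; apply: pf_weight => //; exact: pf_integral.
- move=> h nh.
  have nhk : nneg (fun v : (R * R) * E => h (v.1, g v.2) * (k v.1.1 v.2)%:E).
    apply: nnegM.
      have ms : measurable_fun setT (fun v : (R * R) * E => (v.1, g v.2)).
        by apply: measurable_fun_pair => //; exact: measurableT_comp.
      exact: (nneg_comp ms nh).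
    split => [v|]; first by rewrite lee_fin.
    apply/measurable_EFinP.
    have ms : measurable_fun setT (fun v : (R * R) * E => (v.1.1, v.2)).
      by apply: measurable_fun_pair => //; exact: measurableT_comp.
    exact: (measurableT_comp mk ms).
  exact: (nneg_integral_section m nhk).2.
- move=> x h nh.
  pose f (v : R * E) := h (g v.2, v.1) * (k x v.2)%:E.
  have [f0 mf] : nneg f.
    apply: nnegM.
      have ms : measurable_fun setT (fun v : R * E => (g v.2, v.1)).
        by apply: measurable_fun_pair => //; exact: measurableT_comp.
      exact: (nneg_comp ms nh).
    split => [v|]; first by rewrite lee_fin.
    by apply/measurable_EFinP; exact: measurableT_comp.
  have := @fubini_tonelli _ _ _ _ _ (@lebesgue_measure R) m f mf f0.
  rewrite /density_family => ->; apply: eq_integral => e _.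
  under eq_integral do rewrite /f /= muleC.
  rewrite ge0_integralZl ?lee_fin//; [by rewrite muleC| |by move=> z _; exact: nh.1].
    have mj : measurable_fun setT (pair (g e) : R -> R * R)
      by exact: measurable_pair1.
    exact: (measurableT_comp nh.2 mj).
- move=> A B mA mB; rewrite -law//; apply: eq_integral => w _.
Qed.

End DensityDisintegration.

(** * Disintegrations over a countable set *)

Section FactorThrough.
Local Open Scope ereal_scope.

(** The factor is h(x) = inf of the rationals q such that x lies in B_q, where
    B_q is a measurable set whose preimage under X is the set where Y < q. *)
Lemma factor_through d d' (T : measurableType d) (S : measurableType d')
    (R : realType) (X : T -> S) (Y : T -> R) :
  sigma_of (EFin \o Y) `<=` sigma_of X ->
  exists2 h : S -> R, measurable_fun setT h & forall w, Y w = h (X w).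
Proof.
move=> YX.
have preB (q : rat) : exists Bq : set S, measurable Bq /\
    forall w, Bq (X w) = (Y w < ratr q)%R.
  have : sigma_of (EFin \o Y) [set w | (Y w < ratr q)%R].
    exists `]-oo, (ratr q)%:E[%classic; first exact: emeasurable_itv.
    by apply/seteqP; split => w /=; rewrite in_itv /= lte_fin; [case|split].
  move=> /YX[Bq mBq BqE]; exists Bq; split => // w.
  by move/seteqP : BqE => [h1 h2]; apply/propext; split => [?|/h2[]//]; apply: h1.
have [B BE] := choice preB.
pose f n x : \bar R := if @choice.unpickle rat n is Some q then
  (if x \in B q then (ratr q)%:E else +oo) else +oo.
have mf n : measurable_fun setT (f n).
  rewrite /f; case: choice.unpickle => [q|]; last exact: measurable_cst.
  apply: measurable_fun_ifT; [|exact: measurable_cst..].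
  apply: (measurable_fun_bool true); rewrite setTI.
  rewrite (_ : _ @^-1` _ = B q); first exact: (BE q).1.
  by apply/seteqP; split => x /= => [/set_mem|/mem_set].
exists (fine \o (fun x => einfs (f ^~ x) 0%N)).
  apply: measurableT_comp; first exact: fine_measurable.
  exact: measurable_fun_einfs.
move=> w /=; rewrite (_ : einfs _ _ = (Y w)%:E)//.
apply/eqP; rewrite eq_le; apply/andP; split; last first.
  apply: le_ereal_inf_tmp => _ [n _ <-]; rewrite /f.
  case: choice.unpickle => [q|]; last exact: leey.
  case: ifPn => [|_]; last exact: leey.
  by rewrite inE (BE q).2 lee_fin => /ltW.
apply/lee_addgt0Pr => e e0.
have [q /itvP qe] : exists q : rat, ratr q \in `]Y w, (Y w + e)%R[.
  by have /rat_in_itvoo[q ?] : (Y w < Y w + e)%R; [rewrite ltrDl|exists q].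
rewrite -EFinD; apply: (@le_trans _ _ (ratr q)%:E); last first.
  by rewrite lee_fin qe.
apply: ereal_inf_lbound; exists (choice.pickle q) => //.
by rewrite /f choice.pickleK mem_set// (BE q).2 qe.
Qed.

End FactorThrough.

Section CountableDisintegration.
Local Open Scope ereal_scope.
Context {R : realType}.
HB.instance Definition _ := @Measure_isSigmaFinite.Build _ nat R
  (@counting nat R) (sigma_finite_counting R).

Variables (S : set R) (f : R -> nat).
Hypothesis injf : {in S &, injective f}.

(** Left inverse of the injection [f] on S; the default value 0 is taken outside
    the image of S, where all weights vanish. *)
Definition decode (n : nat) : R := xget 0%R [set y | S y /\ f y = n].

Lemma decodeP n : (f @` S) n -> S (decode n) /\ f (decode n) = n.
Proof. by move=> [y Sy fy]; apply: (xgetPex 0%R (P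
  := [set y | S y /\ f y = n])); exists y. Qed.

Lemma decodeK y : S y -> decode (f y) = y.
Proof.
move=> Sy; have [Sd fd] := decodeP (imageP f Sy).
by apply: injf; rewrite ?inE.
Qed.

Lemma esum_counting (a : R -> \bar R) : (forall y, S y -> 0 <= a y) ->
  \esum_(y in S) a y =
  \int[@counting _ R]_n (if n \in f @` S then a (decode n) else 0).
Proof.
move=> a0.
have bij : set_bij (f @` S) S decode.
  split => [n /decodeP[]//|n n'|y Sy].
    move=> /set_mem/decodeP[_ fn] /set_mem/decodeP[_ fn'] e.
    by rewrite -fn -fn' e.
  by exists (f y); [exact: imageP|exact: decodeK].
have if0 n : 0 <= (if n \in f @` S then a (decode n) else 0).
  by case: ifPn => // /set_mem /decodeP[? _]; exact: a0.
rewrite (@reindex_esum _ _ _ _ _ _ _ bij) esum_mkcond ge0_integral_count//.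
by rewrite nneseries_esumT.
Qed.

Variables (rho : R -> R -> R).
Hypothesis mrho : forall y, measurable_fun setT (rho y).

(** Versions of conditional probabilities are nonnegative only almost surely,
    whereas a density has to be so everywhere: hence the positive part. *)
Definition atom_weight (x : R) (n : nat) : R :=
  if n \in f @` S then Num.max (rho (decode n) x) 0%R else 0%R.

Lemma atom_weight_ge0 x n : (0 <= atom_weight x n)%R.
Proof. by rewrite /atom_weight; case: ifPn => // _;
  rewrite le_max lexx orbT. Qed.

Lemma measurable_atom_weight n : measurable_fun setT (atom_weight ^~ n).
Proof.
rewrite /atom_weight; case: (n \in f @` S); last exact: measurable_cst.
by apply: measurable_maxr; [exact: (mrho (decode n))|exact: measurable_cst].
Qed.

Lemma measurable_atom_weight2 :
  measurable_fun setT (fun u : R * nat => atom_weight u.1 u.2).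
Proof.
move=> _ B mB; rewrite setTI.
rewrite (_ : _ @^-1` _ =
    \bigcup_n ((atom_weight ^~ n @^-1` B) `*` [set n])); last first.
  apply/seteqP; split => [[x n] /= Bx|[x n] [m _ [/= Bx ->]]] //.
  by exists n.
apply: bigcup_measurable => n _; apply: measurableX => //.
exact: preimageT_measurable (measurable_atom_weight n) mB.
Qed.

(** The event that X1 lies in B is, up to a null set, the disjoint union over the
    atoms y in B of the events that X1 = y. *)
Lemma disintegration_countable d (T : measurableType d) (P : probability T R)
    (X0 X1 : T -> R) :
  measurable_fun setT X0 -> measurable_fun setT X1 ->
  measurable S -> P (~` (X1 @^-1` S)) = 0 ->
  (forall y A, S y -> measurable A ->
    \int[P]_(w in X0 @^-1` A) (Num.max (rho y (X0 w)) 0%R)%:E =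
    P (X0 @^-1` A `&` X1 @^-1` [set y])) ->
  disintegration P X0 X1 (@density_family R _ nat (@counting _ R) decode atom_weight).
Proof.
move=> mX0 mX1 mS PS law.
apply: disintegration_density => //.
- exact: measurable_atom_weight2.
- exact: atom_weight_ge0.
move=> A B mA mB; have mA0 := preimageT_measurable mX0 mA.
pose a n w := (\1_B (decode n) * atom_weight (X0 w) n)%:E.
have a0 n w : 0 <= a n w by rewrite lee_fin mulr_ge0 ?atom_weight_ge0// indicE.
have ma n : measurable_fun (X0 @^-1` A) (a n).
  apply: measurable_funTS; apply/measurable_EFinP; apply: measurable_funM.
    exact: measurable_cst.
  exact: (measurableT_comp (measurable_atom_weight n) mX0).
transitivity (\int[P]_(w in X0 @^-1` A) \sum_(n <oo) a n w).
  by apply: eq_integral => w _; rewrite ge0_integral_count// => n; exact: a0.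
rewrite integral_nneseries//.
pose G n := if (n \in f @` S) && (decode n \in B)
  then X0 @^-1` A `&` X1 @^-1` [set decode n] else set0.
have mG n : measurable (G n).
  by rewrite /G; case: ifPn => // _; apply: measurableI => //;
    exact: preimageT_measurable.
have tG : trivIset setT G.
  move=> i j _ _; rewrite /G; case: ifPn => [/andP[/set_mem iS _]|_]; last first.
    by rewrite set0I => -[].
  case: ifPn => [/andP[/set_mem jS _]|_]; last by rewrite setI0 => -[].
  move=> [w [[_ /= wi] [_ /= wj]]].
  have [_ <-] := decodeP iS; have [_ <-] := decodeP jS.
  by rewrite -wi -wj.
transitivity (\sum_(n <oo) P (G n)).
  apply: eq_eseriesr => n _; rewrite /a /G /atom_weight.
  have [nS|nS] /= := boolP (n \in f @` S); last first.
    by rewrite measure0 integral0_eq// => w _; rewrite mulr0.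
  have [Sn _] := decodeP (set_mem nS).
  rewrite indicE; case: (decode n \in B) => /=; last first.
    by rewrite measure0 integral0_eq// => w _; rewrite mul0r.
  by under eq_integral do rewrite mul1r; rewrite law.
rewrite -measure_semi_bigcup//; last exact: bigcup_measurable.
have GE : \bigcup_n G n = (X0 @^-1` A `&` X1 @^-1` B) `&` X1 @^-1` S.
  apply/seteqP; split => [w [n _]|w [[Aw Bw] Sw]].
    rewrite /G; case: ifPn => // /andP[/set_mem nS /set_mem nB] [Aw /= Xw].
    by rewrite /= Xw; have [] := decodeP nS.
  exists (f (X1 w)) => //; rewrite /G (decodeK Sw) mem_set/=;
    last exact: imageP.
  by rewrite mem_set.
have mAB : measurable (X0 @^-1` A `&` X1 @^-1` B).
  by apply: measurableI => //; exact: preimageT_measurable.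
have mX1S := preimageT_measurable mX1 mS.
rewrite GE [RHS](measureDI P mAB mX1S) [X in X + _](_ : _ = 0) ?add0e//.
apply: subset_measure0 PS; [exact: measurableD|exact: measurableC|].
by move=> w [].
Qed.

End CountableDisintegration.

(** * From conditional laws to quotients *)

Section Glue.
Local Open Scope ereal_scope.
Context {R : realType}.

Lemma is_quotient_sub (M : R) (Np Nm D : \bar R) :
  [/\ Np \is a fin_num, Nm \is a fin_num, D \is a fin_num, D != 0 &
      M = ((fine Np - fine Nm) / fine D)%R] ->
  is_quotient M (Np - Nm) D.
Proof.
by move=> [fp fm fD D0 ->]; split; rewrite ?fin_numB ?fp ?fm// fineB.
Qed.

Lemma funepos_weighted (T : Type) (a c : T -> R) : (forall y, (0 <= c y)%R) ->
  (fun y => (a y * c y)%:E)^\+ = (fun y => (Num.max (a y) 0%R * c y)%:E).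
Proof.
by move=> c0; apply/funext => y; rewrite funeposE -EFin_max maxr_pMl// mul0r.
Qed.

Lemma funeneg_weighted (T : Type) (a c : T -> R) : (forall y, (0 <= c y)%R) ->
  (fun y => (a y * c y)%:E)^\- = (fun y => (Num.max (- a y)%R 0%R * c y)%:E).
Proof.
by move=> c0; apply/funext => y;
  rewrite funenegE -EFin_max maxr_pMl// mul0r mulNr.
Qed.

Lemma cond_prob_preimage d d' (T : measurableType d) (S : measurableType d')
    (P : probability T R) (X : T -> S) (A : set T) (Y : T -> \bar R) :
  measurable_fun setT X -> measurable A -> is_cond_prob P (sigma_of X) A Y ->
  forall B, measurable B ->
    \int[P]_(w in X @^-1` B) Y w = P (X @^-1` B `&` A).
Proof.
move=> mX mA [_ _ eY] B mB.
have mXB : measurable (X @^-1` B) by exact: preimageT_measurable.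
rewrite eY; last by exists B => //; rewrite setTI.
by rewrite (integral_indic _ mXB mA) setIC.
Qed.

Lemma cond_density_law d d' (T : measurableType d) (S : measurableType d')
    (P : probability T R) (X : T -> S) (Z : T -> R) (p : S -> R -> R) :
  measurable_fun setT X -> measurable_fun setT Z -> is_cond_density P X Z p ->
  forall A C, measurable A -> measurable C ->
    \int[P]_(w in X @^-1` A) \int[lebesgue_measure]_(z in C) (p (X w) z)%:E =
    P (X @^-1` A `&` Z @^-1` C).
Proof.
move=> mX mZ [_ _ pP] A C mA mC.
have mZC : measurable (Z @^-1` C) by exact: preimageT_measurable.
exact: (cond_prob_preimage mX mZC (pP _ mC) mA).
Qed.

Lemma sub_sigma_process d (T : measurableType d) (J : set R) (Y : R -> T -> R)
    (u v : R) : J u -> J v ->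
  sigma_of (fun w => (Y u w, Y v w)) `<=` sigma_process J Y.
Proof.
move=> Ju Jv.
pose TJ := g_sigma_algebraType [set A | exists2 t, J t & sigma_of (Y t) A].
have mY t : J t -> measurable_fun setT (Y t : TJ -> R).
  move=> Jt _ B mB; apply: sub_sigma_algebra; exists t => //.
  by exists B.
have mYY : measurable_fun setT ((fun w => (Y u w, Y v w)) : TJ -> R * R).
  by apply: measurable_fun_pair; exact: mY.
by move=> _ [B mB <-]; exact: mYY.
Qed.

Lemma sigma_process_sub d (T : measurableType d) (J : set R) (Y : R -> T -> R)
    (G : set (set T)) :
  sigma_algebra setT G -> (forall t, J t -> sigma_of (Y t) `<=` G) ->
  sigma_process J Y `<=` G.
Proof.
move=> sG YG; apply: smallest_sub => // A [t Jt]; exact: YG.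
Qed.

End Glue.

Section Rap.
Context {d : measure_display} {T : measurableType d} {R : realType}.
Variables (T0 T1 : R) (D : R -> T -> R) (X0 X1 : T -> R) (f0 f1 g0 g1 : R -> R).
Hypotheses (hf : interpolating T0 T1 f0 f1) (hg : interpolating T0 T1 g0 g1).
Let I := rap T0 T1 D X0 X1 f0 f1 g0 g1.

Lemma rap_start : I T0 = X0.
Proof.
have [_ _ [f00 f01] [f10 f11]] := hf; have [_ _ [g00 g01] [g10 g11]] := hg.
by apply/funext => w; rewrite /I /rap f00 f10 g00 g10; lra.
Qed.

Lemma rap_end : I T1 = X1.
Proof.
have [_ _ [f00 f01] [f10 f11]] := hf; have [_ _ [g00 g01] [g10 g11]] := hg.
by apply/funext => w; rewrite /I /rap f01 f11 g01 g11; lra.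
Qed.

Hypotheses (mD : forall t, measurable_fun setT (D t))
  (mX0 : measurable_fun setT X0) (mX1 : measurable_fun setT X1).

Lemma measurable_rap t : measurable_fun setT (I t).
Proof.
apply: measurable_funB => //; apply: measurable_funD; apply: measurable_funB;
  by apply: measurable_funM => //; exact: measurable_cst.
Qed.

(** Since T1 comes after t, the instants available at time t are T0 and t. *)
Lemma sigma_markov_times t : T0 < t < T1 ->
  sigma_process (markov_times T0 T1 t) I = sigma_of (fun w => (X0 w, I t w)).
Proof.
move=> /andP[T0t tT1]; rewrite -rap_start.
apply/seteqP; split; last first.
  by apply: sub_sigma_process; [left; split; [left|exact: ltW]|right].
apply: sigma_process_sub.
  exact/sigma_algebra_preimage/sigma_algebra_measurable.
move=> u [[[->|->] ut]|->] _ [B mB <-].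
- exists (B `*` setT); first exact: measurableX.
  by apply/seteqP; split => w /=; [case=> _ []|case].
- by move: ut; rewrite leNgt tT1.
- exists (setT `*` B); first exact: measurableX.
  by apply/seteqP; split => w /=; [case=> _ []|case].
Qed.

End Rap.

Section Cases.
Local Open Scope ereal_scope.
Context {d : measure_display} {T : measurableType d} {R : realType}.
Variables (P : probability T R) (X0 X1 Z : T -> R) (M : T -> R).
Variable p : R * R -> R -> R.
Hypotheses (mX0 : measurable_fun setT X0) (mX1 : measurable_fun setT X1).
Hypothesis p0 : forall x z, (0 <= p x z)%R.

(** Bayes' formula for all disintegrations at once; each case below supplies the
    one that computes its numerator and denominator. *)
Hypothesis bayes_M : forall Lam, disintegration P X0 X1 Lam ->
  {ae P, forall w, is_quotient (M w)
    (Lam (X0 w) (fun y => (Num.max y 0%R * p (X0 w, y) (Z w))%:E) -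
     Lam (X0 w) (fun y => (Num.max (- y)%R 0%R * p (X0 w, y) (Z w))%:E))
    (Lam (X0 w) (fun y => (p (X0 w, y) (Z w))%:E))}.

Lemma quotient_stieltjes (F : R -> cumulativeBounded (0 : R) (1 : R)) :
  is_cond_cdf P X0 X1 F ->
  {ae P, forall w, is_quotient (M w)
    (\int[lebesgue_stieltjes_measure (F (X0 w))]_y (y * p (X0 w, y) (Z w))%:E)
    (\int[lebesgue_stieltjes_measure (F (X0 w))]_y (p (X0 w, y) (Z w))%:E)}.
Proof.
move=> cF.
have mF y : measurable_fun setT (fun x => F x y) := (cF y).1.
have dF : disintegration P X0 X1 (stieltjes_family F).
  apply: disintegration_stieltjes => // A y mA.
  have e : X1 @^-1` `]-oo, y] = [set w | (X1 w <= y)%R].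
    by apply/seteqP; split => w /=; rewrite in_itv.
  rewrite e; apply: (cond_prob_preimage mX0 _ (cF y).2) => //.
  by rewrite -e; apply: preimageT_measurable.
apply: filterS (bayes_M dF) => w.
rewrite [X in _ -> is_quotient _ X _]integralE funepos_weighted// funeneg_weighted//.
Qed.

Lemma quotient_density (k : R -> R -> R) : is_cond_density P X0 X1 k ->
  {ae P, forall w, is_quotient (M w)
    (\int[lebesgue_measure]_y (y * p (X0 w, y) (Z w) * k (X0 w) y)%:E)
    (\int[lebesgue_measure]_y (p (X0 w, y) (Z w) * k (X0 w) y)%:E)}.
Proof.
move=> ck; have [mk k0 _] := ck.
have dk : disintegration P X0 X1
    (@density_family R _ (measurableTypeR R) (@lebesgue_measure R) id k).
  apply: disintegration_density => //.
  move=> A B mA mB; rewrite -(cond_density_law mX0 mX1 ck mA mB).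
  apply: eq_integral => w _; rewrite [RHS]integral_mkcond.
  apply: eq_integral => y _; rewrite patchE indicE.
  by case: ifPn => _; rewrite ?mul1r ?mul0r.
apply: filterS (bayes_M dk) => w.
have c0 y : (0 <= p (X0 w, y) (Z w) * k (X0 w) y)%R by rewrite mulr_ge0.
under [X in _ -> is_quotient _ X _]eq_integral do rewrite -mulrA.
rewrite [X in _ -> is_quotient _ X _]integralE.
rewrite funepos_weighted// funeneg_weighted//; congr is_quotient.
  by congr (_ - _); apply: eq_integral => y _; rewrite -EFinM mulrA.
Qed.

(** Almost surely all the weights are nonnegative at once, since there are
    countably many of them; there, positive and negative parts of the summands
    are those of y, and the sums over S are integrals against the density. *)
Lemma quotient_countable (S : set R) (r : R -> T -> R) : countable S ->
  P (~` (X1 @^-1` S)) = 0 ->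
  (forall y, is_cond_prob P (sigma_of X0) [set w | X1 w = y] (EFin \o r y)) ->
  {ae P, forall w, is_quotient (M w)
    (signed_sum S (fun y => (y * p (X0 w, y) (Z w) * r y w)%:E))
    (signed_sum S (fun y => (p (X0 w, y) (Z w) * r y w)%:E))}.
Proof.
move=> cS PS cr; have [f injf] := countable_injP S cS.
have mS : measurable S by exact: countable_measurable.
have m1 y : measurable [set w | X1 w = y].
  by apply: (preimageT_measurable mX1 (B := [set y])).
have fac y : exists h : R -> R, measurable_fun setT h /\ forall w, r y w = h (X0 w).
  have [sr _ _] := cr y; have [h mh hE] := factor_through sr.
  by exists h.
have [rho rhoP] := choice fac.
have mrho y : measurable_fun setT (rho y) := (rhoP y).1.
have sX0 : sigma_algebra setT (sigma_of X0).
  exact/sigma_algebra_preimage/sigma_algebra_measurable.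
have X0m : sigma_of X0 `<=` measurable.
  by move=> _ [B mB <-]; rewrite setTI; exact: preimageT_measurable.
have r0 y : {ae P, forall w, (0 <= r y w)%R}.
  exact: (cond_prob_ge0 sX0 X0m (m1 y) (cr y)).
have dr : disintegration P X0 X1
    (@density_family R _ nat (@counting _ R) (decode S f) (atom_weight S f rho)).
  apply: disintegration_countable => // y A Sy mA.
  have mA0 := preimageT_measurable mX0 mA.
  rewrite -(cond_prob_preimage mX0 (m1 y) (cr y) mA).
  have mr : measurable_fun setT (r y).
    rewrite (_ : r y = rho y \o X0); first exact: measurableT_comp.
    by apply/funext => w; rewrite (rhoP y).2.
  have [_ ir _] := cr y.
  apply: ae_eq_integral => //.
  - apply/measurable_EFinP; apply: measurable_funTS; apply: measurable_maxr.
      exact: (measurableT_comp (mrho y)).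
    exact: measurable_cst.
  - by apply/measurable_EFinP; exact: measurable_funTS.
  - apply: filterS (r0 y) => w rw _ /=.
    by rewrite -(rhoP y).2; congr EFin; apply/max_idPl.
have r0n : {ae P, forall w, forall n, (0 <= r (decode S f n) w)%R}.
  by apply: ae_foralln => n; exact: r0.
apply: filterS2 r0n (bayes_M dr) => w rw.
have wE n : n \in f @` S -> atom_weight S f rho (X0 w) n = r (decode S f n) w.
  by move=> nS; rewrite /atom_weight nS -(rhoP _).2; apply/max_idPl.
have rS y : S y -> (0 <= r y w)%R.
  by move=> Sy; rewrite -(decodeK injf Sy); exact: rw.
have sumE (c : R -> R) : (forall y, (0 <= c y)%R) ->
    density_family (@counting nat R) (decode S f) (atom_weight S f rho) (X0 w)
      (EFin \o c) = \esum_(y in S) (c y * r y w)%:E.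
  move=> c0; rewrite (esum_counting injf).
    apply: eq_integral => n _; rewrite -EFinM.
    case: ifPn => [nS|nS]; first by rewrite wE.
    by rewrite /atom_weight (negbTE nS) mulr0.
  by move=> y Sy; rewrite lee_fin mulr_ge0 ?rS.
have signedE (a c : R -> R) : (forall y, (0 <= c y)%R) ->
    signed_sum S (fun y => (a y * c y * r y w)%:E) =
    \esum_(y in S) (Num.max (a y) 0%R * c y * r y w)%:E -
    \esum_(y in S) (Num.max (- a y)%R 0%R * c y * r y w)%:E.
  move=> c0; rewrite /signed_sum; congr (_ - _); apply: eq_esum => y /rS ry.
    by rewrite funeposE -EFin_max !maxr_pMl ?mulr_ge0// ?mul0r.
  by rewrite funenegE -EFin_max !maxr_pMl ?mulr_ge0// ?mul0r !mulNr.
have max0 (a : R) : (0 <= Num.max a 0)%R by rewrite le_max lexx orbT.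
rewrite signedE//.
rewrite -(sumE (fun y => Num.max y 0%R * p (X0 w, y) (Z w))%R); last first.
  by move=> y; rewrite mulr_ge0.
rewrite -(sumE (fun y => Num.max (- y)%R 0%R * p (X0 w, y) (Z w))%R);
  last first.
  by move=> y; rewrite mulr_ge0.
suff -> : signed_sum S (fun y => (p (X0 w, y) (Z w) * r y w)%:E) =
  \esum_(y in S) (p (X0 w, y) (Z w) * r y w)%:E by rewrite -sumE.
rewrite /signed_sum [X in _ - X]esum1 ?sube0.
  by apply: eq_esum => y /rS ry; rewrite funeposE -EFin_max max_l// mulr_ge0.
by move=> y /rS ry; rewrite funenegE -EFin_max max_r// oppr_le0 mulr_ge0.
Qed.

End Cases.

(** * The formula for the filtered arcade martingale *)

Unset Implicit Arguments.

Theorem proposition5p5 (d : measure_display) (T : measurableType d)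
  (R : realType) (P : probability T R) (T0 T1 : R)
  (D : R -> {RV P >-> R}) (X0 X1 : {RV P >-> R})
  (f0 f1 g0 g1 : R -> R) (M : R -> T -> R)
  (hT0 : 0 <= T0) (hT01 : T0 < T1)
  (hD : is_driver T0 T1 D)
  (hDdens : forall t : R, T0 <= t <= T1 ->
     has_density P (@lebesgue_measure R) (D t))
  (hindep : independent_sigma P
     (sigma_of (fun w => (X0 w, X1 w)))
     (sigma_process `[T0, T1] (fun t => D t : T -> R)))
  (hX0 : P.-integrable setT (EFin \o X0))
  (hX1 : P.-integrable setT (EFin \o X1))
  (hmart : is_cond_exp P (sigma_of X0) (EFin \o X1) (EFin \o X0))
  (hf : interpolating T0 T1 f0 f1) (hg : interpolating T0 T1 g0 g1) :
  let X := fun w => (X0 w, X1 w) in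
  let I := rap T0 T1 (fun t => D t : T -> R) X0 X1 f0 f1 g0 g1 in
  conditionally_markov P T0 T1 I ->
  is_fam P T0 T1 I X1 M ->
  forall t : R, T0 < t < T1 ->
  forall p : R * R -> R -> R, is_cond_density P X (I t) p ->
  [/\ (* general case *)
      forall F : R -> cumulativeBounded (0 : R) (1 : R),
        is_cond_cdf P X0 X1 F ->
        {ae P, forall w, is_quotient (M t w)
           (\int[lebesgue_stieltjes_measure (F (X0 w))]_y
              (y * p (X0 w, y) (I t w))%:E)%E
           (\int[lebesgue_stieltjes_measure (F (X0 w))]_y
              (p (X0 w, y) (I t w))%:E)%E},
      (* (X0, X1) continuous *)
      has_density P ((@lebesgue_measure R) \x (@lebesgue_measure R))%E X ->
      forall k : R -> R -> R, is_cond_density P X0 X1 k ->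
        {ae P, forall w, is_quotient (M t w)
           (\int[lebesgue_measure]_y
              (y * p (X0 w, y) (I t w) * k (X0 w) y)%:E)%E
           (\int[lebesgue_measure]_y
              (p (X0 w, y) (I t w) * k (X0 w) y)%:E)%E}
    & (* (X0, X1) discrete, with values in the countable set C *)
      forall C : set (R * R), countable C -> P (X @^-1` C) = 1%E ->
      forall r : R -> T -> R,
        (forall y : R, is_cond_prob P (sigma_of X0) [set w | X1 w = y]
           (EFin \o r y)) ->
        {ae P, forall w, is_quotient (M t w)
           (signed_sum (snd @` C)
              (fun y => (y * p (X0 w, y) (I t w) * r y w)%:E))
           (signed_sum (snd @` C)
              (fun y => (p (X0 w, y) (I t w) * r y w)%:E))}].
Proof.
move=> X I hmarkov hfam t tT p hp.
have mX0 : measurable_fun setT (X0 : T -> R) by exact: measurable_funPT.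
have mX1 : measurable_fun setT (X1 : T -> R) by exact: measurable_funPT.
have mD u : measurable_fun setT (D u : T -> R) by exact: measurable_funPT.
have mI u : measurable_fun setT (I u) by exact: measurable_rap.
have mX : measurable_fun setT X by exact: measurable_fun_pair.
have [mp p0 _] := hp.
have plaw := cond_density_law mX (mI t) hp.
have [T0t tT1] := andP tT.
have IT0 : I T0 = X0 by exact: rap_start.
have IT1 : I T1 = X1 by exact: rap_end.
pose F := natural_filtration T0 I t.
have sF : sigma_algebra setT F by exact: smallest_sigma_algebra.
have Fm : F `<=` measurable.
  apply: sigma_process_sub; first exact: sigma_algebra_measurable.
  by move=> u _ _ [B mB <-]; exact: mI.
have XZF : sigma_of (fun w => (X0 w, I t w)) `<=` F.
  by rewrite -IT0; apply: sub_sigma_process; rewrite /= in_itv/= ?lexx ?ltW.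
have markov B : measurable B -> exists Y,
    is_cond_prob P F (X1 @^-1` B) Y /\
    is_cond_prob P (sigma_of (fun w => (X0 w, I t w))) (X1 @^-1` B) Y.
  (* the process at T1 is X1, so the Markov property from t to T1 is about X1 *)
  move=> mB; have [Y] := hmarkov t T1 (ltW T0t) (ltW tT1) (lexx _) B mB.
  by rewrite IT1 sigma_markov_times//; exists Y.
have condM : is_cond_exp P F (EFin \o X1) (EFin \o M t).
  by apply: hfam; rewrite (ltW T0t) (ltW tT1).
have bayes_M Lam : disintegration P X0 X1 Lam -> {ae P, forall w, is_quotient (M t w)
    (Lam (X0 w) (fun y => (Num.max y 0%R * p (X0 w, y) (I t w))%:E) -
     Lam (X0 w) (fun y => (Num.max (- y)%R 0%R * p (X0 w, y) (I t w))%:E))%E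
    (Lam (X0 w) (fun y => (p (X0 w, y) (I t w))%:E))}.
  move=> disL.
  apply: filterS (bayes_formula disL mX0 mX1 (mI t) mp p0 plaw sF Fm XZF
    markov hX1 condM) => w.
  exact: is_quotient_sub.
split.
- by move=> G hG; exact: (quotient_stieltjes mX0 mX1 p0 bayes_M hG).
- by move=> _ k hk; exact: (quotient_density mX0 mX1 p0 bayes_M hk).
- move=> C cC PC r hr.
  have mC : measurable C.
    apply: countable_measurable => // -[x y].
    rewrite (_ : [set (x, y)] = [set x] `*` [set y]); first exact: measurableX.
    by apply/seteqP; split => [_ ->|[a b] [/= -> ->]].
  have cS : countable (snd @` C) := card_le_trans (card_image_le _ _) cC.
  apply: (quotient_countable mX0 mX1 p0 bayes_M cS) => //.
  have mXC : measurable (X @^-1` C) by exact: preimageT_measurable.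
  have mS : measurable (snd @` C) by exact: countable_measurable.
  have PCc : P (~` (X @^-1` C)) = 0%E by rewrite probability_setC// PC subee.
  apply: subset_measure0 PCc.
  + by apply: measurableC; exact: preimageT_measurable.
  + exact: measurableC.
  + by apply: subsetC => w Cw; exists (X w).
Qed.
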